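(* Let $\phi$ be a sentence of FO(Type, Aggregate) over a vocabulary $\Sigma$, and let $\overline{\chi(\phi)}$ be its translation, a sentence over the lifted vocabulary $\Sigma_l$. For each non-built-in type $T$ of $\Sigma$, fix a natural number $n_T$ (the number of concrete elements of $T$). Then the following are equivalent: 1. $\phi$ has a model, i.e. a $\Sigma$-structure $I$ with $|T^I|=n_T$ for each such type $T$, in which $\phi$ is true. 2. $\overline{\chi(\phi)}$ has a model, i.e. a $\Sigma_l$-structure $L$ with $\sum_{l\in T^L}\mathit{mul}_T^L(l)=n_T$ for each such type $T$, in which $\overline{\chi(\phi)}$ is true.
   Context: **The logic FO(Type, Aggregate).** This is typed first-order logic with the following features. - Types are interpreted as disjoint sets. Non-built-in types are finite. Built-in types are $\mathbb{B}$ (booleans), $\mathbb{N}$ and $\mathbb{Q}$ (rationals). - It has predicate symbols and total function symbols with type signatures. It has built-in equality, arithmetic operations $+,-,\times,\div$ and comparisons $<,>,\le,\ge$. - Quantification $\forall\bar x\in\bar T$ and $\exists\bar x\in\bar T$ is over finite types only. - It has sum aggregates $\sum\{\{t\mid \bar x\in\bar T:\psi\}\}$: the sum, with multiplicity, of the values of the term $t$ over all assignments to $\bar x$ (ranging over finite types $\bar T$) that make $\psi$ true. A cardinality aggregate is a sum aggregate with $t=1$. - Equality is treated as a binary predicate. **Lifted vocabulary.** $\Sigma_l$ is $\Sigma$ together with, for each type $T$, a function $\mathit{mul}_T:T\to\mathbb{N}$. Elements of built-in numeric and boolean types are taken to have multiplicity $1$. **Multiplicity notation.** For a tuple of terms or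 variables $\bar u=(u_1,\dots,u_k)$: - $\mathit{Mul}(\bar u)=\prod_i\mathit{mul}(u_i)$, where $\mathit{mul}(u)$ is the multiplicity of the value of $u$; - $\mathit{Lcm}(\bar u)$ is the least common multiple of these multiplicities, with the convention that it is $0$ if some multiplicity is $0$. **The transformation $\chi$.** It is defined recursively. Terms: - $\chi(x)=x$ and $\chi(c())=c()$. - $\chi(f(\bar t))=f(\chi(\bar t))$. - $\chi(t_1\oplus t_2)=\chi(t_1)\oplus\chi(t_2)$ for $\oplus\in\{+,-,\times,\div\}$. - Special aggregate rule: $\chi\big(\sum\{\{t\mid\bar x\in\bar T: p(\bar t,s)\wedge\psi\}\}\big)=\sum\{\{\frac{\mathit{Mul}(\bar x)\,\mathit{Lcm}(\chi(\bar t),\chi(s))}{\mathit{Lcm}(\chi(\bar t))\,\mathit{mul}(\chi(s))}\times\chi(t)\mid \bar x\in\bar T: 0<\mathit{Mul}(\bar x)\wedge p(\chi(\bar t),\chi(s))\wedge\chi(\psi)\}\}$. This applies only when the variables of $\bar t$ are among $\bar x$ and $s$ contains none of $\bar x$. - General aggregate rule (otherwise): $\chi\big(\sum\{\{t\mid\bar x\in\bar T:\psi\}\}\big)=\sum\{\{\mathit{Mul}(\bar x)\times\chi(t)\mid\bar x\in\bar T:0<\mathit{Mul}(\bar x)\wedge\chi(\psi)\}\}$. Formulas: - $\chi(p())=p()$ and $\chi(p(\bar t))=p(\chi(\bar t))$. - $\chi(t_1\sim t_2)=\chi(t_1)\sim\chi(t_2)$ for $\sim\in\{<,>,\le,\ge\}$.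 - $\chi$ commutes with $\wedge,\vee,\Rightarrow,\Leftrightarrow,\neg$. - A formula $T\triangleq\{t_1,\dots,t_n\}$, stating that type $T$ has $n$ elements, becomes $\sum_{x\in T}\mathit{mul}(x)=n$. - Special quantifier rules, applicable under the same variable condition as the special aggregate rule: - $\chi(\forall\bar x\in\bar T: p(\bar t,s)\Rightarrow\psi)=\forall\bar x\in\bar T:0<\mathit{Mul}(\bar x)\wedge p(\chi(\bar t),\chi(s))\Rightarrow\chi(\psi)$; - $\chi(\exists\bar x\in\bar T:p(\bar t,s)\wedge\psi)=\exists\bar x\in\bar T:0<\mathit{Mul}(\bar x)\wedge p(\chi(\bar t),\chi(s))\wedge\chi(\psi)$. - General quantifier rules (otherwise): - $\chi(\forall\bar x\in\bar T:\psi)=\forall\bar x\in\bar T:0<\mathit{Mul}(\bar x)\Rightarrow\chi(\psi)$; - $\chi(\exists\bar x\in\bar T:\psi)=\exists\bar x\in\bar T:0<\mathit{Mul}(\bar x)\wedge\chi(\psi)$. **The translation $\overline{\chi(\phi)}$.** It is the conjunction of $\chi(\phi)$ with the following regularity constraints. 1. For every atom $p(\bar t)$ with $n$-ary $p$, $n\ge1$, translated by the atom rule (i.e. not absorbed as the $p(\bar t,s)$ of a special rule), add $\forall\bar x\in\bar T_{\bar x}: p(\chi(\bar t))\Rightarrow \mathit{Mul}(\bar x)=\mathit{Lcm}(\bar x)\vee\mathit{Mul}(\chi(\bar t))=\mathit{Lcm}(\chi(\bar t))$, where $\bar x$ are the variables of $p(\chi(\bar t))$ with their types $\bar T_{\bar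 x}$. 2. For every function symbol $f:\bar T\to T$ of $\Sigma$, add both - $\forall\bar x\in\bar T:\mathit{Mul}(\bar x)=\mathit{Lcm}(\bar x)$, and - $\forall\bar x\in\bar T:\exists n\in\mathbb{N}:\mathit{Mul}(\bar x)=n\times\mathit{mul}(f(\bar x))$. The lifted sentence is evaluated in a $\Sigma_l$-structure $L$ by the usual semantics, with quantifiers and aggregates over $T$ ranging over $T^L$. *)

(* Defs.v *)
From HB Require Import structures.
From mathcomp Require Import all_boot all_order all_algebra.
From mathcomp Require Import boolp.

Set Implicit Arguments.
Unset Strict Implicit.
Unset Printing Implicit Defensive.

Import GRing.Theory Num.Theory.
Local Open Scope ring_scope.

Inductive ty (S : Type) := TyBool | TyNat | TyRat | TySym of S.
Arguments TyBool {S}.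
Arguments TyNat {S}.
Arguments TyRat {S}.

Definition ty_code (S : Type) (T : ty S) : option (option (option S)) :=
  match T with
  | TyBool => None
  | TyNat => Some None
  | TyRat => Some (Some None)
  | TySym s => Some (Some (Some s))
  end.

Definition ty_decode (S : Type) (c : option (option (option S))) : ty S :=
  match c with
  | None => TyBool
  | Some None => TyNat
  | Some (Some None) => TyRat
  | Some (Some (Some s)) => TySym s
  end.

Lemma ty_codeK (S : Type) : cancel (@ty_code S) (@ty_decode S).
Proof. by case. Qed.

HB.instance Definition _ (S : eqType) :=
  Equality.copy (ty S) (can_type (@ty_codeK S)).

(* There are finitely many function symbols because the translation of a
   sentence contains conjuncts for each of them; the type symbols are finite
   in number because each contributes a function symbol to the lifted
   vocabulary. *)
Record vocab := Vocab {
  tsym : finType;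
  fsym : finType;
  psym : Type;
  fdom : fsym -> seq (ty tsym);
  fcod : fsym -> ty tsym;
  pdom : psym -> seq (ty tsym)
}.

(* The lifted vocabulary: [inr T] is the symbol mul_T : T -> nat. *)
Definition lifted (V : vocab) : vocab := {|
  tsym := tsym V;
  fsym := (fsym V + tsym V)%type;
  psym := psym V;
  fdom := fun f => match f with
                   | inl g => fdom g
                   | inr T => [:: TySym T]
                   end;
  fcod := fun f => match f with inl g => fcod g | inr _ => TyNat end;
  pdom := fun p => @pdom V p
|}.

(* A variable carries its type, so that "x ranges over T" is read off x. *)
Definition var (V : vocab) : Type := (nat * ty (tsym V))%type.

Inductive arith := OAdd | OSub | OMul | ODiv.
Inductive cmp := CLt | CGt | CLe | CGe.

Inductive predicate (V : vocab) := PEq | PSym of psym V.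
Arguments PEq {V}.

(* Raw expressions, shared by source and lifted sentences; [sentence] below
   carves out the sentences of FO(Type, Aggregate).  [TLcm] and quantification
   over infinite types are used by the translation only.
   [TSum t xs psi] is the sum of the multiset {{ t | xs : psi }}.
   [FEnum T n] is the formula T := {t_1, ..., t_n}, stating that T has n
   elements; the names t_i play no other role and are omitted.
   The predicate of an atom may be equality, so the special rules also apply
   to equations. *)
Inductive term (V : vocab) :=
  | TVar of var V
  | TBool of bool
  | TNum of rat
  | TApp of fsym V & seq (term V)
  | TArith of arith & term V & term V
  | TLcm of seq (term V)
  | TSum of term V & seq (var V) & formula V
with formula (V : vocab) :=
  | FTrue
  | FAtom of predicate V & seq (term V)
  | FCmp of cmp & term V & term V
  | FEnum of tsym V & nat
  | FNot of formula V
  | FAnd of formula V & formula V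
  | FOr of formula V & formula V
  | FImp of formula V & formula V
  | FIff of formula V & formula V
  | FAll of seq (var V) & formula V
  | FEx of seq (var V) & formula V.
Arguments TBool {V}.
Arguments TNum {V}.
Arguments FTrue {V}.
Arguments FEnum {V}.

(* Free variables, possibly with repetitions. *)
Fixpoint fv_term (V : vocab) (t : term V) : seq (var V) :=
  match t with
  | TVar x => [:: x]
  | TBool _ | TNum _ => [::]
  | TApp _ ts => flatten (map (@fv_term V) ts)
  | TArith _ t1 t2 => fv_term t1 ++ fv_term t2
  | TLcm ts => flatten (map (@fv_term V) ts)
  | TSum t xs psi => [seq x <- fv_term t ++ fv_form psi | x \notin xs]
  end
with fv_form (V : vocab) (phi : formula V) : seq (var V) :=
  match phi with
  | FTrue | FEnum _ _ => [::]
  | FAtom _ ts => flatten (map (@fv_term V) ts)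
  | FCmp _ t1 t2 => fv_term t1 ++ fv_term t2
  | FNot a => fv_form a
  | FAnd a b | FOr a b | FImp a b | FIff a b => fv_form a ++ fv_form b
  | FAll xs a | FEx xs a => [seq x <- fv_form a | x \notin xs]
  end.

(* The natural numbers are a subset of the rationals. *)
Definition subty (S : eqType) (T U : ty S) : bool :=
  (T == U) || (T == TyNat) && (U == TyRat).

Definition is_num (S : eqType) (T : ty S) : bool := subty T TyRat.

Definition comparable_ty (S : eqType) (T U : ty S) : bool :=
  (T == U) || is_num T && is_num U.

Definition is_fin (S : Type) (T : ty S) : bool :=
  match T with TyBool | TySym _ => true | TyNat | TyRat => false end.

Fixpoint ty_of (V : vocab) (t : term V) : ty (tsym V) :=
  match t with
  | TVar x => x.2
  | TBool _ => TyBool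
  | TNum q => if q \is a Num.nat then TyNat else TyRat
  | TApp f _ => fcod f
  | TArith o t1 t2 =>
      match o with
      | OAdd | OMul =>
          if (ty_of t1 == TyNat) && (ty_of t2 == TyNat) then TyNat else TyRat
      | OSub | ODiv => TyRat
      end
  | TLcm _ => TyNat
  | TSum t _ _ => if ty_of t == TyNat then TyNat else TyRat
  end.

Definition wf_args (V : vocab) (ts : seq (term V)) (Ts : seq (ty (tsym V))) :=
  all2 (fun t T => subty (ty_of t) T) ts Ts.

Definition wf_atom (V : vocab) (p : predicate V) (ts : seq (term V)) : bool :=
  match p with
  | PEq => if ts is [:: t1; t2] then comparable_ty (ty_of t1) (ty_of t2)
           else false
  | PSym p => wf_args ts (pdom p)
  end.

Definition wf_binder (V : vocab) (xs : seq (var V)) : bool :=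
  uniq xs && all (fun x => is_fin x.2) xs.

Fixpoint wf_term (V : vocab) (t : term V) : bool :=
  match t with
  | TVar _ | TBool _ | TNum _ => true
  | TApp f ts => wf_args ts (fdom f) && all (@wf_term V) ts
  | TArith _ t1 t2 =>
      [&& is_num (ty_of t1), is_num (ty_of t2), wf_term t1 & wf_term t2]
  | TLcm _ => false
  | TSum t xs psi =>
      [&& is_num (ty_of t), wf_binder xs, wf_term t & wf_form psi]
  end
with wf_form (V : vocab) (phi : formula V) : bool :=
  match phi with
  | FTrue | FEnum _ _ => true
  | FAtom p ts => wf_atom p ts && all (@wf_term V) ts
  | FCmp _ t1 t2 =>
      [&& is_num (ty_of t1), is_num (ty_of t2), wf_term t1 & wf_term t2]
  | FNot a => wf_form a
  | FAnd a b | FOr a b | FImp a b | FIff a b => wf_form a && wf_form b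
  | FAll xs a | FEx xs a => wf_binder xs && wf_form a
  end.

Definition sentence (V : vocab) (phi : formula V) : bool :=
  wf_form phi && (fv_form phi == [::]).

(* Tagging elements with their type symbol makes the non-built-in types
   disjoint from one another and from the built-in ones. *)
Inductive value (S : Type) (D : S -> Type) :=
  | VBool of bool
  | VNum of rat
  | VElt (s : S) of D s.
Arguments VBool {S D}.
Arguments VNum {S D}.
Arguments VElt {S D}.

Definition has_ty (S : eqType) (D : S -> Type) (v : value D) (T : ty S) :
    bool :=
  match v, T with
  | VBool _, TyBool => true
  | VNum q, TyNat => q \is a Num.nat
  | VNum _, TyRat => true
  | VElt s _, TySym s' => s == s'
  | _, _ => false
  end.

(* The interpretations are irrelevant on ill-typed arguments. *)
Record structure (V : vocab) := Structure {
  dom : tsym V -> finType;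
  fint : fsym V -> seq (value dom) -> value dom;
  pint : psym V -> seq (value dom) -> bool;
  fint_ty : forall f vs,
    all2 (@has_ty _ dom) vs (fdom f) -> has_ty (fint f vs) (fcod f)
}.

Section Semantics.
Variables (V : vocab) (M : structure V).

Definition elem : Type := value (dom M).
Definition env : Type := var V -> elem.

Definition num_of (v : elem) : rat := if v is VNum q then q else 0.

Definition upd (e : env) (x : var V) (v : elem) : env :=
  fun y => if y == x then v else e y.

(* Only meaningful for finite types. *)
Definition enum_ty (T : ty (tsym V)) : seq elem :=
  match T with
  | TyBool => [:: VBool true; VBool false]
  | TySym s => [seq VElt s d | d <- enum (dom M s)]
  | TyNat | TyRat => [::]
  end.

(* All modifications of [e] assigning values of the right types to [xs]. *)
Fixpoint envs (xs : seq (var V)) (e : env) : seq env :=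
  if xs is x :: xs' then
    flatten [seq envs xs' (upd e x v) | v <- enum_ty x.2]
  else [:: e].

Fixpoint all_envs (xs : seq (var V)) (P : env -> Prop) (e : env) : Prop :=
  if xs is x :: xs' then
    forall v : elem, has_ty v x.2 -> all_envs xs' P (upd e x v)
  else P e.

Fixpoint ex_envs (xs : seq (var V)) (P : env -> Prop) (e : env) : Prop :=
  if xs is x :: xs' then
    exists2 v : elem, has_ty v x.2 & ex_envs xs' P (upd e x v)
  else P e.

(* Division is total, with q / 0 = 0. *)
Definition arith_sem (o : arith) : rat -> rat -> rat :=
  match o with
  | OAdd => fun a b => a + b
  | OSub => fun a b => a - b
  | OMul => fun a b => a * b
  | ODiv => fun a b => a / b
  end.

Definition cmp_sem (c : cmp) : rat -> rat -> bool :=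
  match c with
  | CLt => fun a b => a < b
  | CGt => fun a b => a > b
  | CLe => fun a b => a <= b
  | CGe => fun a b => a >= b
  end.

Definition pred_sem (p : predicate V) (vs : seq elem) : Prop :=
  match p with
  | PEq => if vs is [:: v; w] then v = w else False
  | PSym p => pint p vs
  end.

(* [lcmn m n] is 0 as soon as m or n is. *)
Fixpoint eval (e : env) (t : term V) {struct t} : elem :=
  match t with
  | TVar x => e x
  | TBool b => VBool b
  | TNum q => VNum q
  | TApp f ts => fint f (map (eval e) ts)
  | TArith o t1 t2 => VNum (arith_sem o (num_of (eval e t1)) (num_of (eval e t2)))
  | TLcm ts =>
      VNum (\big[lcmn/1%N]_(v <- map (eval e) ts) Num.truncn (num_of v))%:R
  | TSum t xs psi =>
      VNum (\sum_(e' <- envs xs e | `[< sat e' psi >]) num_of (eval e' t))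
  end
with sat (e : env) (phi : formula V) {struct phi} : Prop :=
  match phi with
  | FTrue => True
  | FAtom p ts => pred_sem p (map (eval e) ts)
  | FCmp c t1 t2 => cmp_sem c (num_of (eval e t1)) (num_of (eval e t2))
  | FEnum T n => #|dom M T| = n
  | FNot a => ~ sat e a
  | FAnd a b => sat e a /\ sat e b
  | FOr a b => sat e a \/ sat e b
  | FImp a b => sat e a -> sat e b
  | FIff a b => sat e a <-> sat e b
  | FAll xs a => all_envs xs (fun e' => sat e' a) e
  | FEx xs a => ex_envs xs (fun e' => sat e' a) e
  end.

(* For a sentence the choice of the initial assignment is immaterial. *)
Definition models (phi : formula V) : Prop := sat (fun _ => VBool false) phi.

End Semantics.

Section Translation.
Variable V : vocab.
Local Notation lterm := (term (lifted V)).
Local Notation lform := (formula (lifted V)).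

Definition tmul (a b : lterm) : lterm := TArith OMul a b.
Definition tdiv (a b : lterm) : lterm := TArith ODiv a b.
Definition form_eq (a b : lterm) : lform := FAtom PEq [:: a; b].

Definition mul_of (u : lterm) : lterm :=
  match ty_of u with
  | TySym T => @TApp (lifted V) (inr T) [:: u]
  | _ => TNum 1
  end.

Definition Mul (us : seq lterm) : lterm := foldr tmul (TNum 1) (map mul_of us).
Definition Lcm (us : seq lterm) : lterm := TLcm (map mul_of us).

Definition Mulv (xs : seq (var V)) : lterm := Mul (map (@TVar (lifted V)) xs).
Definition Lcmv (xs : seq (var V)) : lterm := Lcm (map (@TVar (lifted V)) xs).

Definition pos_mul (xs : seq (var V)) : lform := FCmp CLt (TNum 0) (Mulv xs).

Definition lift_pred (p : predicate V) : predicate (lifted V) :=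
  match p with PEq => PEq | PSym q => @PSym (lifted V) q end.

Fixpoint split_last (A : Type) (s : seq A) : option (seq A * A) :=
  match s with
  | [::] => None
  | x :: s' => if split_last s' is Some (s0, y) then Some (x :: s0, y)
               else Some ([::], x)
  end.

(* The side condition of the special rules for an atom p(ts), with
   ts = rcons tb s. *)
Definition special (xs : seq (var V)) (ts : seq (term V)) : bool :=
  if split_last ts is Some (tb, s) then
    all (mem xs) (flatten (map (@fv_term V) tb)) && ~~ has (mem xs) (fv_term s)
  else false.

(* Mul(xs) Lcm(tb, s) / (Lcm(tb) mul(s)), with us = rcons tb s. *)
Definition special_factor (xs : seq (var V)) (us : seq lterm) : lterm :=
  if split_last us is Some (tb, s) then
    tdiv (tmul (Mulv xs) (Lcm us)) (tmul (Lcm tb) (mul_of s))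
  else TNum 1.

Fixpoint chi_term (t : term V) : lterm :=
  match t with
  | TVar x => @TVar (lifted V) x
  | TBool b => TBool b
  | TNum q => TNum q
  | TApp f ts => @TApp (lifted V) (inl f) (map chi_term ts)
  | TArith o t1 t2 => TArith o (chi_term t1) (chi_term t2)
  | TLcm ts => TLcm (map chi_term ts)
  | TSum t xs body =>
      let general :=
        @TSum (lifted V) (tmul (Mulv xs) (chi_term t)) xs
          (FAnd (pos_mul xs) (chi_form body)) in
      match body with
      | FAnd (FAtom p ts) psi =>
          if special xs ts then
            let us := map chi_term ts in
            @TSum (lifted V) (tmul (special_factor xs us) (chi_term t)) xs
              (FAnd (pos_mul xs) (FAnd (FAtom (lift_pred p) us) (chi_form psi)))
          else general
      | _ => general
      end
  end
with chi_form (phi : formula V) : lform :=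
  match phi with
  | FTrue => FTrue
  | FAtom p ts => FAtom (lift_pred p) (map chi_term ts)
  | FCmp c t1 t2 => FCmp c (chi_term t1) (chi_term t2)
  | FEnum T n =>
      let x : var (lifted V) := (0%N, TySym T) in
      form_eq (@TSum (lifted V) (mul_of (TVar x)) [:: x] FTrue) (TNum n%:R)
  | FNot a => FNot (chi_form a)
  | FAnd a b => FAnd (chi_form a) (chi_form b)
  | FOr a b => FOr (chi_form a) (chi_form b)
  | FImp a b => FImp (chi_form a) (chi_form b)
  | FIff a b => FIff (chi_form a) (chi_form b)
  | FAll xs body =>
      let general := @FAll (lifted V) xs (FImp (pos_mul xs) (chi_form body)) in
      match body with
      | FImp (FAtom p ts) psi =>
          if special xs ts then
            @FAll (lifted V) xs
              (FImp (FAnd (pos_mul xs) (FAtom (lift_pred p) (map chi_term ts)))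
                    (chi_form psi))
          else general
      | _ => general
      end
  | FEx xs body =>
      let general := @FEx (lifted V) xs (FAnd (pos_mul xs) (chi_form body)) in
      match body with
      | FAnd (FAtom p ts) psi =>
          if special xs ts then
            @FEx (lifted V) xs
              (FAnd (pos_mul xs)
                 (FAnd (FAtom (lift_pred p) (map chi_term ts)) (chi_form psi)))
          else general
      | _ => general
      end
  end.

Definition reg_atom (p : predicate V) (ts : seq (term V)) : seq lform :=
  if ts is [::] then [::] else
  let us := map chi_term ts in
  let atom := FAtom (lift_pred p) us in
  let xs := undup (fv_form atom) in
  [:: @FAll (lifted V) xs
        (FImp atom
           (FOr (form_eq (Mulv xs) (Lcmv xs)) (form_eq (Mul us) (Lcm us))))].

(* The constraints for the atoms translated by the atom rule; an atom absorbed
   by a special rule contributes only the constraints of the atoms occurring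
   inside its arguments. *)
Fixpoint reg_term (t : term V) : seq lform :=
  match t with
  | TVar _ | TBool _ | TNum _ => [::]
  | TApp _ ts | TLcm ts => flatten (map reg_term ts)
  | TArith _ t1 t2 => reg_term t1 ++ reg_term t2
  | TSum t xs body =>
      let general := reg_term t ++ reg_form body in
      match body with
      | FAnd (FAtom p ts) psi =>
          if special xs ts then
            reg_term t ++ flatten (map reg_term ts) ++ reg_form psi
          else general
      | _ => general
      end
  end
with reg_form (phi : formula V) : seq lform :=
  match phi with
  | FTrue | FEnum _ _ => [::]
  | FAtom p ts => reg_atom p ts ++ flatten (map reg_term ts)
  | FCmp _ t1 t2 => reg_term t1 ++ reg_term t2
  | FNot a => reg_form a
  | FAnd a b | FOr a b | FImp a b | FIff a b => reg_form a ++ reg_form b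
  | FAll xs body =>
      match body with
      | FImp (FAtom p ts) psi =>
          if special xs ts then flatten (map reg_term ts) ++ reg_form psi
          else reg_form body
      | _ => reg_form body
      end
  | FEx xs body =>
      match body with
      | FAnd (FAtom p ts) psi =>
          if special xs ts then flatten (map reg_term ts) ++ reg_form psi
          else reg_form body
      | _ => reg_form body
      end
  end.

(* The numbering of [xs] starts at 0, so [n] is distinct from all of them. *)
Definition reg_fun (f : fsym V) : seq lform :=
  let xs : seq (var (lifted V)) := zip (iota 0 (size (fdom f))) (fdom f) in
  let n : var (lifted V) := (size xs, TyNat) in
  let fxs := @TApp (lifted V) (inl f) (map (@TVar (lifted V)) xs) in
  [:: @FAll (lifted V) xs (form_eq (Mulv xs) (Lcmv xs));
      @FAll (lifted V) xs
        (@FEx (lifted V) [:: n]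
           (form_eq (Mulv xs) (tmul (TVar n) (mul_of fxs))))].

Definition bigconj (phis : seq lform) : lform :=
  foldr (@FAnd (lifted V)) FTrue phis.

Definition translate (phi : formula V) : lform :=
  bigconj (chi_form phi :: reg_form phi ++ flatten (map reg_fun (enum (fsym V)))).

End Translation.

Definition mul_elt (V : vocab) (L : structure (lifted V)) (T : tsym V)
    (l : dom L T) : rat :=
  num_of (fint (s:=L) (inr T) [:: VElt T l]).

(* Main.v *)
Require Import Defs.
From HB Require Import structures.
From mathcomp Require Import all_boot all_order all_algebra.
From mathcomp Require Import boolp.

Set Implicit Arguments.
Unset Strict Implicit.
Unset Printing Implicit Defensive.

Import Order.TTheory GRing.Theory Num.Theory.
Local Open Scope ring_scope.

(* From a model of [phi], give every element multiplicity 1.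

   Conversely, replace each lifted element l of multiplicity m by the concrete
   elements (l, i) with i in Z/m.  The integers act on concrete elements by
   shifting all indices, and a tuple is k-coherent if its indices are the
   residues of one integer k.  The constraints on a function symbol f say that
   every argument tuple is coherent (Chinese remainders) and that f can be
   defined by sending a k-coherent tuple over ls to (f ls, k); this commutes
   with shifts.  For a relation p and a tuple (tb, s), fix an equivariant
   "phase" of tb modulo the lcm of its multiplicities, equal to k when tb is
   k-coherent, and let p hold if it holds of the lifted elements and the index
   of s is congruent to the phase of tb modulo gcd(Lcm(tb), mul(s)).  The second
   condition is automatic on coherent tuples, which settles the atoms subject to
   the regularity constraint; under a special rule tb is shifted along with the
   bound variables while s is fixed, so exactly one in gcd(Lcm(tb), mul(s)) of
   the concrete assignments over a lifted one satisfies it, which is the factor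
   Lcm(tb, s) / (Lcm(tb) mul(s)). *)

(** * Classical equality and choice structures on syntax, values and assignments *)

HB.instance Definition _ (V : vocab) := gen_eqMixin (term V).
HB.instance Definition _ (V : vocab) := gen_eqMixin (formula V).
HB.instance Definition _ (S : Type) (D : S -> Type) := gen_eqMixin (value D).
HB.instance Definition _ (S : Type) (D : S -> Type) := gen_choiceMixin (value D).
HB.instance Definition _ (V : vocab) (M : structure V) := gen_eqMixin (env M).

(** * Mutual induction on terms and formulas *)

Section Induction.
Variables (V : vocab) (Pt : term V -> Prop) (Pf : formula V -> Prop).

Hypothesis HVar : forall x, Pt (TVar x).
Hypothesis HBool : forall b, Pt (TBool b).
Hypothesis HNum : forall q, Pt (TNum q).
Hypothesis HApp : forall f ts, {in ts, forall t, Pt t} -> Pt (TApp f ts).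
Hypothesis HArith : forall o t1 t2, Pt t1 -> Pt t2 -> Pt (TArith o t1 t2).
Hypothesis HLcm : forall ts, {in ts, forall t, Pt t} -> Pt (TLcm ts).
Hypothesis HTrue : Pf FTrue.
Hypothesis HAtom : forall p ts, {in ts, forall t, Pt t} -> Pf (FAtom p ts).
Hypothesis HCmp : forall c t1 t2, Pt t1 -> Pt t2 -> Pf (FCmp c t1 t2).
Hypothesis HEnum : forall T n, Pf (FEnum T n).
Hypothesis HNot : forall a, Pf a -> Pf (FNot a).
Hypothesis HAnd : forall a b, Pf a -> Pf b -> Pf (FAnd a b).
Hypothesis HOr : forall a b, Pf a -> Pf b -> Pf (FOr a b).
Hypothesis HImp : forall a b, Pf a -> Pf b -> Pf (FImp a b).
Hypothesis HIff : forall a b, Pf a -> Pf b -> Pf (FIff a b).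

Section Plain.
Hypothesis HSum : forall t xs a, Pt t -> Pf a -> Pt (TSum t xs a).
Hypothesis HAll : forall xs a, Pf a -> Pf (FAll xs a).
Hypothesis HEx : forall xs a, Pf a -> Pf (FEx xs a).

Lemma in_nil_all : {in [::], forall t, Pt t}.
Proof. by []. Qed.

Lemma in_cons_all t ts :
  Pt t -> {in ts, forall t, Pt t} -> {in t :: ts, forall t, Pt t}.
Proof. by move=> Ht Hts u; rewrite inE => /predU1P[->|/Hts]. Qed.

(** The inner fixpoint [args] walks through an argument list, so that the recursive calls on its
    members are visibly calls on subterms. *)
Fixpoint term_plain_ind (t : term V) : Pt t :=
  let fix args ts : {in ts, forall t, Pt t} :=
    match ts with
    | [::] => in_nil_all
    | t :: ts' => in_cons_all (term_plain_ind t) (args ts')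
    end in
  match t with
  | TVar x => HVar x
  | TBool b => HBool b
  | TNum q => HNum q
  | TApp f ts => HApp f (args ts)
  | TArith o t1 t2 => HArith o (term_plain_ind t1) (term_plain_ind t2)
  | TLcm ts => HLcm (args ts)
  | TSum t xs a => HSum xs (term_plain_ind t) (form_plain_ind a)
  end
with form_plain_ind (a : formula V) : Pf a :=
  let fix args ts : {in ts, forall t, Pt t} :=
    match ts with
    | [::] => in_nil_all
    | t :: ts' => in_cons_all (term_plain_ind t) (args ts')
    end in
  match a with
  | FTrue => HTrue
  | FAtom p ts => HAtom p (args ts)
  | FCmp c t1 t2 => HCmp c (term_plain_ind t1) (term_plain_ind t2)
  | FEnum T n => HEnum T n
  | FNot a => HNot (form_plain_ind a)
  | FAnd a b => HAnd (form_plain_ind a) (form_plain_ind b)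
  | FOr a b => HOr (form_plain_ind a) (form_plain_ind b)
  | FImp a b => HImp (form_plain_ind a) (form_plain_ind b)
  | FIff a b => HIff (form_plain_ind a) (form_plain_ind b)
  | FAll xs a => HAll xs (form_plain_ind a)
  | FEx xs a => HEx xs (form_plain_ind a)
  end.

Lemma plain_ind : (forall t, Pt t) /\ (forall a, Pf a).
Proof. by split; [exact: term_plain_ind | exact: form_plain_ind]. Qed.

End Plain.
End Induction.

(** A special rule looks two levels down: it translates the arguments of the guarding atom and the
    remaining formula, but never the body as a whole. The induction hypothesis for the body is then
    of no use, and this one about its pieces takes its place. *)
Definition guarded_hyp (V : vocab) (Pt : term V -> Prop) (Pf : formula V -> Prop)
    (a : formula V) : Prop :=
  match a with
  | FAnd (FAtom _ ts) b | FImp (FAtom _ ts) b =>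
      {in ts, forall t, Pt t} /\ Pf b
  | _ => True
  end.

Section GuardedInduction.
Variables (V : vocab) (Pt : term V -> Prop) (Pf : formula V -> Prop).

Lemma guarded_ind :
  (forall x, Pt (TVar x)) -> (forall b, Pt (TBool b)) ->
  (forall q, Pt (TNum q)) ->
  (forall f ts, {in ts, forall t, Pt t} -> Pt (TApp f ts)) ->
  (forall o t1 t2, Pt t1 -> Pt t2 -> Pt (TArith o t1 t2)) ->
  (forall ts, {in ts, forall t, Pt t} -> Pt (TLcm ts)) ->
  (forall t xs a, Pt t -> Pf a -> guarded_hyp Pt Pf a -> Pt (TSum t xs a)) ->
  Pf FTrue ->
  (forall p ts, {in ts, forall t, Pt t} -> Pf (FAtom p ts)) ->
  (forall c t1 t2, Pt t1 -> Pt t2 -> Pf (FCmp c t1 t2)) ->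
  (forall T n, Pf (FEnum T n)) ->
  (forall a, Pf a -> Pf (FNot a)) ->
  (forall a b, Pf a -> Pf b -> Pf (FAnd a b)) ->
  (forall a b, Pf a -> Pf b -> Pf (FOr a b)) ->
  (forall a b, Pf a -> Pf b -> Pf (FImp a b)) ->
  (forall a b, Pf a -> Pf b -> Pf (FIff a b)) ->
  (forall xs a, Pf a -> guarded_hyp Pt Pf a -> Pf (FAll xs a)) ->
  (forall xs a, Pf a -> guarded_hyp Pt Pf a -> Pf (FEx xs a)) ->
  (forall t, Pt t) /\ (forall a, Pf a).
Proof.
move=> HVar HBool HNum HApp HArith HLcm HSum HTrue HAtom HCmp HEnum HNot HAnd
  HOr HImp HIff HAll HEx.
(* The predicate is strengthened: every formula also carries what an enclosing binder may ask of it,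
   and an atom passes on the hypotheses on its arguments. *)
pose atom_args a := if a is FAtom _ ts then {in ts, forall t, Pt t} else True.
suff [? Hf] : (forall t, Pt t) /\
    (forall a, Pf a /\ (atom_args a /\ guarded_hyp Pt Pf a)).
  by split=> // a; case: (Hf a).
apply: (@plain_ind V Pt (fun a => Pf a /\ (atom_args a /\ guarded_hyp Pt Pf a))) => //=.
- by move=> p ts H; split; [exact: HAtom | split].
- by move=> c t1 t2 H1 H2; split; [exact: HCmp | split].
- by move=> a [/HNot Ha _].
- move=> a b [Ha [Aa _]] [Hb _]; split; [exact: HAnd | split=> //].
  by case: a Ha Aa.
- by move=> a b [Ha _] [Hb _]; split; [exact: HOr | split].
- move=> a b [Ha [Aa _]] [Hb _]; split; [exact: HImp | split=> //].
  by case: a Ha Aa.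
- by move=> a b [Ha _] [Hb _]; split; [exact: HIff | split].
- by move=> t xs a Ht [Ha [_ Ga]]; apply: HSum.
- by move=> xs a [Ha [_ Ga]]; split; [exact: HAll | split].
- by move=> xs a [Ha [_ Ga]]; split; [exact: HEx | split].
Qed.

End GuardedInduction.

(** * Assignments, iterated binders and free variables *)

Section Environments.
Variables (V : vocab) (M : structure V).

Definition typed_on (xs : seq (var V)) (e : env M) : Prop :=
  {in xs, forall y, has_ty (e y) y.2}.

Definition agree_off (xs : seq (var V)) (e e' : env M) : Prop :=
  forall y, y \notin xs -> e' y = e y.

Lemma updxx (e : env M) x v : upd e x v x = v.
Proof. by rewrite /upd eqxx. Qed.

Lemma agree_off_upd x xs (e e' : env M) v :
  x \notin xs -> agree_off xs (upd e x v) e' -> agree_off (x :: xs) e e' /\ e' x = v.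
Proof.
move=> xxs H; split; last by rewrite H // updxx.
move=> y; rewrite inE negb_or => /andP[yx yxs].
by rewrite H // /upd (negbTE yx).
Qed.

(** Replacing the successive updates by one modified assignment makes later arguments independent of
    the order of binding. *)
Lemma all_envsP xs (P : env M -> Prop) e :
  all_envs xs P e <->
  (forall e', agree_off xs e e' -> typed_on xs e' -> P e').
Proof.
elim: xs e => [|x xs IH] e /=.
  split=> [Pe e' H _ | H]; last by apply: H.
  by have -> : e' = e by apply/funext => y; apply: H.
split=> [H e' Ha Ht | H v vT].
  have vT : has_ty (e' x) x.2 by apply: Ht; rewrite mem_head.
  have /IH := H _ vT; apply.
    move=> y yxs; rewrite /upd; case: eqP => [-> //|/eqP yx].
    by apply: Ha; rewrite inE negb_or yx.
  by move=> y yxs; apply: Ht; rewrite inE yxs orbT.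
apply/IH => e' Ha Ht; apply: H.
  move=> y; rewrite inE negb_or => /andP[yx yxs].
  by rewrite Ha // /upd (negbTE yx).
move=> y; rewrite inE => /predU1P[->|/Ht//].
(* If [x] occurs again in [xs], the inner binder determines its value. *)
have [/Ht//|xxs] := boolP (x \in xs).
by rewrite Ha // updxx.
Qed.

(** By this duality the facts on existential binders are inherited from the universal ones. *)
Lemma ex_envs_not xs (P : env M -> Prop) e :
  ex_envs xs P e <-> ~ all_envs xs (fun e' => ~ P e') e.
Proof.
elim: xs e => [|x xs IH] e /=; first by rewrite notK.
split=> [[v vT /IH H] /(_ v vT)//|H].
apply: contrapT => H'; apply: H => v vT; apply: contrapT => /IH H.
by apply: H'; exists v.
Qed.

Lemma ex_envsP xs (P : env M -> Prop) e :
  ex_envs xs P e <->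
  (exists e', [/\ agree_off xs e e', typed_on xs e' & P e']).
Proof.
rewrite ex_envs_not all_envsP; split=> [H|[e' [Ha Ht Pe]] /(_ e' Ha Ht)//].
apply: contrapT => H'; apply: H => e' Ha Ht Pe; apply: H'.
by exists e'.
Qed.

Lemma sat_FAll xs a (e : env M) :
  sat e (FAll xs a) <->
  (forall e', agree_off xs e e' -> typed_on xs e' -> sat e' a).
Proof. exact: all_envsP. Qed.

Lemma sat_FEx xs a (e : env M) :
  sat e (FEx xs a) <->
  (exists e', [/\ agree_off xs e e', typed_on xs e' & sat e' a]).
Proof. exact: ex_envsP. Qed.

Lemma mem_enum_ty v T : v \in enum_ty M T -> has_ty v T.
Proof.
case: T => [|||s] //=; first by rewrite !inE => /orP[] /eqP ->.
by move=> /mapP[d _ ->] /=.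
Qed.

Lemma envs_agree xs e e' : e' \in envs xs e -> agree_off xs e e' /\ typed_on xs e'.
Proof.
elim: xs e => [|x xs IH] e /=.
  by rewrite inE => /eqP ->.
move=> /flatten_mapP[v /mem_enum_ty vT /IH[Ha Ht]]; split.
  move=> y; rewrite inE negb_or => /andP[yx yxs].
  by rewrite Ha // /upd (negbTE yx).
move=> y; rewrite inE => /predU1P[->|/Ht//].
have [/Ht//|xxs] := boolP (x \in xs).
by rewrite Ha // updxx.
Qed.

Lemma sum_envs_cons x xs e (F : env M -> rat) :
  \sum_(e' <- envs (x :: xs) e) F e' =
  \sum_(v <- enum_ty M x.2) \sum_(e' <- envs xs (upd e x v)) F e'.
Proof. by rewrite /= big_flatten big_map. Qed.

(** Here [P] stands for the variables on which the summands depend. Binding gives both assignments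
    the same values on [xs], so agreement is asked only off [xs]. *)
Lemma sum_envs_rel (P : pred (var V)) xs e1 e2 (F G : env M -> rat) :
  (forall y, P y -> y \notin xs -> e1 y = e2 y) ->
  (forall e1' e2', (forall y, P y -> e1' y = e2' y) -> F e1' = G e2') ->
  \sum_(e' <- envs xs e1) F e' = \sum_(e' <- envs xs e2) G e'.
Proof.
move=> He HFG; elim: xs e1 e2 He => [|x xs IH] e1 e2 He.
  by rewrite /= !big_seq1; apply: HFG => y /He; apply.
rewrite !sum_envs_cons; apply: eq_bigr => v _; apply: IH => y Py yxs.
rewrite /upd; case: eqP => // /eqP yx.
by apply: He; rewrite // inE negb_or yx.
Qed.

Lemma all_envs_rel (P : pred (var V)) xs e1 e2 (F G : env M -> Prop) :
  (forall y, P y -> y \notin xs -> e1 y = e2 y) ->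
  (forall e1' e2', (forall y, P y -> e1' y = e2' y) -> F e1' <-> G e2') ->
  all_envs xs F e1 <-> all_envs xs G e2.
Proof.
move=> He HFG; elim: xs e1 e2 He => [|x xs IH] e1 e2 He /=.
  by apply: HFG => y /He; apply.
have E v : all_envs xs F (upd e1 x v) <-> all_envs xs G (upd e2 x v).
  apply: IH => y Py yxs; rewrite /upd; case: eqP => // /eqP yx.
  by apply: He; rewrite // inE negb_or yx.
by split=> H v vT; apply/E; apply: H.
Qed.

Lemma ex_envs_rel (P : pred (var V)) xs e1 e2 (F G : env M -> Prop) :
  (forall y, P y -> y \notin xs -> e1 y = e2 y) ->
  (forall e1' e2', (forall y, P y -> e1' y = e2' y) -> F e1' <-> G e2') ->
  ex_envs xs F e1 <-> ex_envs xs G e2.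
Proof.
move=> He HFG; rewrite !ex_envs_not.
rewrite (@all_envs_rel P xs e1 e2 (fun e => ~ F e) (fun e => ~ G e)) //.
by move=> ? ? /HFG ->.
Qed.

Lemma coincidence :
  (forall t (e1 e2 : env M), {in fv_term t, e1 =1 e2} -> eval e1 t = eval e2 t) /\
  (forall a (e1 e2 : env M), {in fv_form a, e1 =1 e2} -> sat e1 a <-> sat e2 a).
Proof.
have args ts (e1 e2 : env M) :
    {in ts, forall t, forall e1 e2 : env M,
      {in fv_term t, e1 =1 e2} -> eval e1 t = eval e2 t} ->
    {in flatten (map (@fv_term V) ts), e1 =1 e2} ->
    map (eval e1) ts = map (eval e2) ts.
  move=> IH He; apply/eq_in_map => t tts; apply: IH => // y yt.
  by apply: He; apply/flatten_mapP; exists t.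
apply: plain_ind => //=.
- by move=> x e1 e2 ->; rewrite ?mem_head.
- by move=> f ts IH e1 e2 He; rewrite (args _ _ _ IH He).
- move=> o t1 t2 IH1 IH2 e1 e2 He.
  by rewrite (IH1 e1 e2) 1?(IH2 e1 e2) // => y yt; apply: He; rewrite mem_cat yt ?orbT.
- by move=> ts IH e1 e2 He; rewrite (args _ _ _ IH He).
- by move=> p ts IH e1 e2 He; rewrite (args _ _ _ IH He).
- move=> c t1 t2 IH1 IH2 e1 e2 He.
  by rewrite (IH1 e1 e2) 1?(IH2 e1 e2) // => y yt; apply: He; rewrite mem_cat yt ?orbT.
- by move=> a IH e1 e2 /IH ->.
- move=> a b IHa IHb e1 e2 He.
  by rewrite (IHa e1 e2) 1?(IHb e1 e2) // => y yt; apply: He; rewrite mem_cat yt ?orbT.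
- move=> a b IHa IHb e1 e2 He.
  by rewrite (IHa e1 e2) 1?(IHb e1 e2) // => y yt; apply: He; rewrite mem_cat yt ?orbT.
- move=> a b IHa IHb e1 e2 He.
  by rewrite (IHa e1 e2) 1?(IHb e1 e2) // => y yt; apply: He; rewrite mem_cat yt ?orbT.
- move=> a b IHa IHb e1 e2 He.
  by rewrite (IHa e1 e2) 1?(IHb e1 e2) // => y yt; apply: He; rewrite mem_cat yt ?orbT.
- move=> t xs a IHt IHa e1 e2 He; congr VNum.
  rewrite big_mkcond [RHS]big_mkcond.
  apply: (@sum_envs_rel (mem (fv_term t ++ fv_form a))) => [y yt yxs|e1' e2' E].
    by apply: He; rewrite mem_filter yxs.
  rewrite (IHt e1' e2'); last by move=> y yt; apply: E; rewrite inE mem_cat yt.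
  suff -> : `[< sat e1' a >] = `[< sat e2' a >] by [].
  by apply: asbool_equiv_eq; apply: IHa => y yt; apply: E; rewrite inE mem_cat yt orbT.
- move=> xs a IHa e1 e2 He; apply: (@all_envs_rel (mem (fv_form a))) => [y yt yxs|e1' e2' E].
    by apply: He; rewrite mem_filter yxs.
  exact: IHa.
- move=> xs a IHa e1 e2 He; apply: (@ex_envs_rel (mem (fv_form a))) => [y yt yxs|e1' e2' E].
    by apply: He; rewrite mem_filter yxs.
  exact: IHa.
Qed.

End Environments.

(** * Least common multiples, Chinese remainders and counting of residues *)

Section Congruences.
Local Open Scope nat_scope.
Implicit Types (m g a b k : nat) (ms : seq nat).

Definition prods ms := \prod_(m <- ms) m.
Definition lcms ms := \big[lcmn/1]_(m <- ms) m.

Lemma dvdn_lcms ms n : (lcms ms %| n) = all (fun m => m %| n) ms.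
Proof.
rewrite /lcms; elim: ms => [|m ms IH]; first by rewrite big_nil dvd1n.
by rewrite big_cons dvdn_lcm IH.
Qed.

Lemma dvdn_mem_lcms ms m : m \in ms -> m %| lcms ms.
Proof. by have := dvdnn (lcms ms); rewrite dvdn_lcms => /allP H /H. Qed.

Lemma lcms_gt0 ms : all (leq 1) ms -> 0 < lcms ms.
Proof.
rewrite /lcms; elim: ms => [|m ms IH]; first by rewrite big_nil.
by rewrite /= big_cons lcmn_gt0 => /andP[-> /IH].
Qed.

Lemma prods_gt0 ms : all (leq 1) ms -> 0 < prods ms.
Proof.
rewrite /prods; elim: ms => [|m ms IH]; first by rewrite big_nil.
by rewrite /= big_cons muln_gt0 => /andP[-> /IH].
Qed.

Lemma lcms_dvd_prods ms : lcms ms %| prods ms.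
Proof.
rewrite dvdn_lcms; apply/allP => m mms.
by rewrite /prods (big_rem m) //= dvdn_mulr.
Qed.

Lemma modn_dvd m d a b : d %| m -> a = b %[mod m] -> a = b %[mod d].
Proof. by move=> dm E; rewrite -(modn_dvdm a dm) E modn_dvdm. Qed.

Lemma eqmod_lcms ms a b :
  {in ms, forall m, a = b %[mod m]} -> a = b %[mod lcms ms].
Proof.
wlog le : a b / b <= a => [W H|H].
  case: (leqP b a) => [ba|/ltnW ab]; first exact: W.
  by apply/esym; apply: W => // m /H.
apply/eqP; rewrite eqn_mod_dvd // dvdn_lcms; apply/allP => m /H/eqP.
by rewrite eqn_mod_dvd.
Qed.

(** Positive moduli whose product equals their lcm are pairwise coprime, so residues can be combined
    one modulus at a time. *)
Lemma chinese_seq ms (idxs : seq nat) :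
  all2 ltn idxs ms -> prods ms = lcms ms ->
  exists k, idxs = [seq k %% m | m <- ms].
Proof.
elim: ms idxs => [|m ms IH] [|i idxs] //= ; first by exists 0.
move=> /andP[im H]; rewrite /prods /lcms !big_cons -/(prods _) -/(lcms _) => E.
have m0 : 0 < m by apply: leq_ltn_trans im.
have ms0 : all (leq 1) ms.
  elim: (ms) (idxs) H => [|m' ms' IH'] [|i' idxs'] //= /andP[im' /IH' ->].
  by rewrite (leq_ltn_trans _ im').
have [L0 P0] := (lcms_gt0 ms0, prods_gt0 ms0).
have LP := lcms_dvd_prods ms.
(* The hypothesis passes to the tail: [m * prods ms] is the lcm of [m] and [lcms ms], hence at most
   [m * lcms ms]. *)
have E' : prods ms = lcms ms.
  apply/eqP; rewrite eqn_leq [_ <= prods _]dvdn_leq // andbT.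
  rewrite -(leq_pmul2l m0) E -muln_lcm_gcd leq_pmulr //.
  by rewrite gcdn_gt0 m0.
(* The lcm of [m] and [prods ms] is already their product, so their gcd is 1. *)
have cop : coprime m (prods ms).
  have := muln_lcm_gcd m (prods ms); rewrite {1}E' -E => /eqP.
  by rewrite -{2}(muln1 (m * prods ms)) eqn_pmul2l // muln_gt0 m0.
have [k ->] := IH _ H E'.
exists (chinese m (prods ms) i k); congr cons.
  by rewrite chinese_modl // modn_small.
apply/eq_in_map => x xms; apply: (@modn_dvd (prods ms)).
  exact: dvdn_trans (dvdn_mem_lcms xms) LP.
by rewrite chinese_modr.
Qed.

(** Each of the [q] blocks of [g] consecutive values of [j] meets the required residue exactly
    once. *)
Lemma sum_shift_eqmod g q a b : 0 < g ->
  \sum_(j < q * g) (a == b + j %[mod g]) = q.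
Proof.
move=> g0; rewrite -(big_mkord predT (fun j => (a == b + j %[mod g]) : nat)).
elim: q => [|q IH]; first by rewrite mul0n big_geq.
rewrite mulSnr (big_cat_nat (leq0n (q * g)) (leq_addr g (q * g))) /= IH.
rewrite -{1}(add0n (q * g)) big_addn addKn big_mkord.
(* The residue of [a - b] modulo [g], written without truncated subtraction. *)
pose r := (a + (g - b %% g)) %% g.
have rg : r < g by rewrite ltn_mod.
rewrite (eq_bigr (fun j : 'I_g => nat_of_bool (j == Ordinal rg))); last first.
  move=> j _; congr nat_of_bool; rewrite (addnC (nat_of_ord j)) addnCA modnMDl.
  rewrite -(eqn_modDr (g - b %% g)) -{1}(modn_mod _ g) -/r.
  have -> : b + j + (g - b %% g) = j %[mod g].
    rewrite addnAC -modnDml -[in X in X %% g](modnDml b).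
    by rewrite subnKC ?modnn // ltnW // ltn_mod.
  by rewrite -val_eqE /= (modn_small (ltn_ord j)) (modn_small rg) eq_sym.
rewrite (bigD1 (Ordinal rg)) //= eqxx big1 ?addn0 ?addn1 // => j /negbTE ->.
by [].
Qed.

Lemma shift_eqmod_ex g a b : 0 < g -> exists j, a = b + j %[mod g].
Proof.
move=> g0; exists (a + (g - b %% g)).
rewrite addnCA -modnDmr -[in X in _ = _ + X %[mod _]](modnDml b).
by rewrite subnKC ?modnn ?addn0 // ltnW // ltn_mod.
Qed.

End Congruences.

(** * Multiplicities of values and of terms in a lifted structure *)

Definition ty_sym (S : Type) (T : ty S) : option S :=
  if T is TySym s then Some s else None.

Section Multiplicities.
Variables (V : vocab) (L : structure (lifted V)).

(** The truncation is exact on elements, because the multiplicity functions take natural values. *)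
Definition mulv (w : elem L) : nat :=
  if w is VElt s _ then Num.truncn (num_of (fint (s := L) (inr s) [:: w])) else 1%N.
#[global] Arguments mulv : simpl never.

(** The term [mul_of u] is selected by the static type of [u], whereas [mulv] inspects its value;
    this says that the two readings agree. *)
Definition mul_ok (e : env L) (u : term (lifted V)) : Prop :=
  num_of (eval e (mul_of u)) = (mulv (eval e u))%:R.

Lemma fint_mul (s : tsym V) (d : dom L s) :
  fint (s := L) (inr s) [:: VElt s d] = VNum (mulv (VElt s d))%:R.
Proof.
have := @fint_ty _ L (inr s) [:: VElt s d]; rewrite /mulv /= eqxx => /(_ isT).
by case: (fint _ _) => //= q /truncnK ->.
Qed.

Lemma mul_okP (e : env L) u T :
  has_ty (eval e u) T -> ty_sym (ty_of u) = ty_sym T -> mul_ok e u.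
Proof.
rewrite /mul_ok /mul_of; case: (ty_of u) => [|||s] /=.
- by case: (eval e u) => // s d; case: T.
- by case: (eval e u) => // s d; case: T.
- by case: (eval e u) => // s d; case: T.
case: T => // s' /[swap] -[<-].
case: (eval e u) => //= s'' d /eqP Es; subst s''.
by rewrite fint_mul.
Qed.

Lemma eval_Mul (e : env L) us :
  {in us, forall u, mul_ok e u} ->
  eval e (Mul us) = VNum (prods (map (mulv \o eval e) us))%:R.
Proof.
rewrite /Mul /prods; elim: us => [|u us IH] H; first by rewrite big_nil.
rewrite /= big_cons natrM H ?mem_head // IH // => v vus.
by apply: H; rewrite inE vus orbT.
Qed.

Lemma eval_Lcm (e : env L) us :
  {in us, forall u, mul_ok e u} ->
  eval e (Lcm us) = VNum (lcms (map (mulv \o eval e) us))%:R.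
Proof.
move=> H /=; congr (VNum _%:R); rewrite /lcms !big_map.
by apply: eq_big_seq => u /H /= ->; rewrite natrK.
Qed.

Lemma mul_ok_var (e : env L) (xs : seq (var V)) :
  @typed_on (lifted V) L xs e ->
  {in map (@TVar (lifted V)) xs, forall u, mul_ok e u}.
Proof.
move=> H u /mapP[x xxs ->]; apply: (@mul_okP e (TVar x) x.2) => //=.
exact: H.
Qed.

Lemma eval_Mulv (e : env L) (xs : seq (var V)) :
  @typed_on (lifted V) L xs e ->
  eval e (Mulv xs) = VNum (prods (map (mulv \o e) xs))%:R.
Proof. by move=> H; rewrite eval_Mul -?map_comp //; apply: mul_ok_var. Qed.

Lemma eval_Lcmv (e : env L) (xs : seq (var V)) :
  @typed_on (lifted V) L xs e ->
  eval e (Lcmv xs) = VNum (lcms (map (mulv \o e) xs))%:R.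
Proof. by move=> H; rewrite eval_Lcm -?map_comp //; apply: mul_ok_var. Qed.

Lemma sat_pos_mul (e : env L) (xs : seq (var V)) :
  @typed_on (lifted V) L xs e ->
  sat e (pos_mul xs) <-> all (fun x => 0 < mulv (e x))%N xs.
Proof.
move=> H; rewrite /= eval_Mulv //= ltr0n /prods; clear H.
elim: xs => [|x xs IH] /=; first by rewrite big_nil.
by rewrite big_cons muln_gt0; split=> /andP[-> /IH].
Qed.

Lemma sat_bigconj (e : env L) phis :
  sat e (bigconj phis) <-> {in phis, forall phi, sat e phi}.
Proof.
elim: phis => [|phi phis IH] //=; split=> [[H /IH Hs] a|H].
  by rewrite inE => /predU1P[->|/Hs].
split; first by apply: H; rewrite mem_head.
by apply/IH => a aphis; apply: H; rewrite inE aphis orbT.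
Qed.

End Multiplicities.

(** * Concrete elements, shifts, coherence and phases *)

Section Blowup.
Variables (V : vocab) (L : structure (lifted V)).
Local Notation mulv := (@mulv V L).

(** An element of multiplicity 0 has no concrete copy, since ['I_0] is empty. *)
Definition cdom (s : tsym V) : finType := {d : dom L s & 'I_(mulv (VElt s d))}.
Definition cval : Type := value cdom.

Definition proj (v : cval) : elem L :=
  match v with
  | VBool b => VBool b
  | VNum q => VNum q
  | VElt s d => @VElt _ (dom L) s (tag d)
  end.

Definition idx (v : cval) : nat := if v is VElt s d then tagged d else 0%N.

(** The copy of [w] whose index is the residue of [k]. The default [VBool false] is reached only
    when [w] has multiplicity 0. *)
Definition at_idx (w : elem L) (k : nat) : cval :=
  match w with
  | VBool b => VBool b
  | VNum q => VNum q
  | VElt s d =>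
      if insub (k %% mulv (VElt s d))%N is Some i
      then @VElt _ cdom s (existT (fun d' : dom L s => 'I_(mulv (VElt s d')) : Type) d i)
      else VBool false
  end.

Definition shift (j : nat) (v : cval) : cval := at_idx (proj v) (idx v + j).

Definition coherent (k : nat) (v : cval) : bool := idx v == (k %% mulv (proj v))%N.

Lemma idx_lt v : (idx v < mulv (proj v))%N.
Proof. by case: v => //= s d; apply: ltn_ord. Qed.

Lemma mulv_proj_gt0 v : (0 < mulv (proj v))%N.
Proof. exact: leq_ltn_trans (idx_lt v). Qed.

Lemma proj_at_idx w k : (0 < mulv w)%N -> proj (at_idx w k) = w.
Proof.
case: w => // s d H; rewrite /at_idx; case: insubP => [i _ _ //|].
by rewrite ltn_mod H.
Qed.

Lemma idx_at_idx w k : (0 < mulv w)%N -> idx (at_idx w k) = (k %% mulv w)%N.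
Proof.
case: w => [b|q|s d] H; rewrite ?modn1 //.
by rewrite /at_idx; case: insubP => [i _ //|]; rewrite ltn_mod H.
Qed.

Lemma at_idxK v : at_idx (proj v) (idx v) = v.
Proof.
case: v => // s [d i]; rewrite /at_idx /= modn_small ?ltn_ord //.
by rewrite valK.
Qed.

Lemma at_idx_eqmod w a b : a = b %[mod mulv w] -> at_idx w a = at_idx w b.
Proof. by case: w => // s d E; rewrite /at_idx E. Qed.

Lemma coherentE k v : coherent k v -> v = at_idx (proj v) k.
Proof. by move=> /eqP E; rewrite -{1}(at_idxK v) E; apply: at_idx_eqmod; rewrite modn_mod. Qed.

Lemma coherent_eqmod a b v : a = b %[mod mulv (proj v)] -> coherent a v = coherent b v.
Proof. by rewrite /coherent => ->. Qed.

Lemma coherent_at_idx w k : (0 < mulv w)%N -> coherent k (at_idx w k).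
Proof. by move=> H; rewrite /coherent idx_at_idx // proj_at_idx. Qed.

Lemma proj_shift j v : proj (shift j v) = proj v.
Proof. by rewrite proj_at_idx // mulv_proj_gt0. Qed.

Lemma idx_shift j v : idx (shift j v) = ((idx v + j) %% mulv (proj v))%N.
Proof. by rewrite idx_at_idx // mulv_proj_gt0. Qed.

Lemma cval_inj v1 v2 : proj v1 = proj v2 -> idx v1 = idx v2 -> v1 = v2.
Proof. by move=> E1 E2; rewrite -(at_idxK v1) E1 E2 at_idxK. Qed.

Lemma shift0 v : shift 0 v = v.
Proof. by rewrite /shift addn0 at_idxK. Qed.

Lemma shift_add a b v : shift b (shift a v) = shift (a + b) v.
Proof.
by apply: cval_inj; rewrite ?proj_shift // !idx_shift proj_shift modnDml addnA.
Qed.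

Lemma shift_inj_mod a b v : (shift a v = shift b v) <-> a = b %[mod mulv (proj v)].
Proof.
split=> [/(congr1 idx)|E]; last by apply: at_idx_eqmod; rewrite -modnDmr E modnDmr.
by rewrite !idx_shift => /eqP; rewrite eqn_modDl => /eqP.
Qed.

Lemma coherent_shift k j v : coherent k v -> coherent (k + j) (shift j v).
Proof. by move=> /eqP E; rewrite /coherent idx_shift proj_shift E modnDml. Qed.

Lemma has_ty_proj v T : has_ty (proj v) T = has_ty v T.
Proof. by case: v => // s d; case: T. Qed.

Implicit Type tb : seq cval.

Definition lcmv tb : nat := lcms (map (mulv \o proj) tb).

Lemma lcmv_gt0 tb : (0 < lcmv tb)%N.
Proof. by apply: lcms_gt0; apply/allP => m /mapP[v _ ->]; apply: mulv_proj_gt0. Qed.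

Lemma eqmod_lcmv tb a b :
  {in tb, forall v, a = b %[mod mulv (proj v)]} -> a = b %[mod lcmv tb].
Proof. by move=> H; apply: eqmod_lcms => m /mapP[v /H E ->]. Qed.

Lemma eqmod_lcmv_mem tb a b v :
  a = b %[mod lcmv tb] -> v \in tb -> a = b %[mod mulv (proj v)].
Proof.
move=> E vtb; apply: modn_dvd E; apply: dvdn_mem_lcms.
by apply/mapP; exists v.
Qed.

Lemma lcmv_shift j tb : lcmv (map (shift j) tb) = lcmv tb.
Proof. by rewrite /lcmv -map_comp; congr lcms; apply/eq_map => v /=; rewrite proj_shift. Qed.

Definition all_coherent k tb : bool := all (coherent k) tb.

Lemma all_coherent_uniq tb a b : all_coherent a tb -> all_coherent b tb -> a = b %[mod lcmv tb].
Proof.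
move=> /allP Ha /allP Hb; apply: eqmod_lcmv => v vtb.
by rewrite -(eqP (Ha v vtb)) (eqP (Hb v vtb)).
Qed.

Lemma all_coherent_shift k j tb : all_coherent k tb -> all_coherent (k + j) (map (shift j) tb).
Proof. by rewrite /all_coherent all_map; apply: sub_all => v; apply: coherent_shift. Qed.

Lemma all_coherent_ex tb :
  prods (map (mulv \o proj) tb) = lcmv tb -> exists k, all_coherent k tb.
Proof.
move=> E; have H : all2 ltn (map idx tb) (map (mulv \o proj) tb).
  by elim: (tb) => //= v tb' ->; rewrite idx_lt.
have [k Ek] := chinese_seq H E.
exists k; elim: (tb) Ek => //= v tb' IH [Ev /IH ->].
by rewrite /coherent Ev eqxx.
Qed.

(** An integer inducing all indices of the tuple, determined modulo [lcmv tb] by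
    [all_coherent_uniq]; it is 0 by default when there is none. *)
Definition common_index tb : nat :=
  if pselect (exists k, all_coherent k tb) is left H then xchoose H else 0%N.

Lemma common_indexP tb k : all_coherent k tb -> all_coherent (common_index tb) tb.
Proof.
rewrite /common_index => H; case: pselect => [H'|[]]; last by exists k.
exact: (xchooseP H').
Qed.

Definition orbit_of tb : pred (seq cval) :=
  fun tb' => `[< exists j, tb' = map (shift j) tb >].

Lemma orbit_refl tb : orbit_of tb tb.
Proof. by apply/asboolP; exists 0%N; rewrite (eq_map shift0) map_id. Qed.

Lemma map_shift_add a b tb : map (shift b) (map (shift a) tb) = map (shift (a + b)) tb.
Proof. by rewrite -map_comp; apply/eq_map => v /=; rewrite shift_add. Qed.

Lemma map_shift_inj_mod a b tb :
  map (shift a) tb = map (shift b) tb <-> a = b %[mod lcmv tb].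
Proof.
rewrite -eq_in_map; split=> H.
  by apply: eqmod_lcmv => v /H /shift_inj_mod.
by move=> v /(eqmod_lcmv_mem H) /shift_inj_mod.
Qed.

Lemma map_shift_inv j tb : exists j', map (shift j') (map (shift j) tb) = tb.
Proof.
(* Shifting the tuple has period [lcmv tb], so a nonnegative inverse shift exists: the two shifts
   add up to [j * lcmv tb]. *)
exists (j * (lcmv tb).-1)%N; rewrite map_shift_add -mulnS prednK ?lcmv_gt0 //.
have -> : map (shift (j * lcmv tb)) tb = map (shift 0) tb.
  by apply/map_shift_inj_mod; rewrite modnMl mod0n.
by rewrite (eq_map shift0) map_id.
Qed.

Lemma orbit_shift j tb : orbit_of (map (shift j) tb) =1 orbit_of tb.
Proof.
move=> tb'; apply: asbool_equiv_eq; split=> [[k ->]|[k ->]].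
  by exists (j + k)%N; rewrite map_shift_add.
have [j' {1}<-] := map_shift_inv j tb.
by exists (j' + k)%N; rewrite -map_shift_add.
Qed.

(** The choice depends on the orbit alone, so all shifts of a tuple are measured from one origin. *)
Definition orbit_rep tb : seq cval := choose (orbit_of tb) tb.

Lemma orbit_rep_shift j tb : orbit_rep (map (shift j) tb) = orbit_rep tb.
Proof.
rewrite /orbit_rep (eq_choose (orbit_shift j tb)); apply: choose_id.
  by apply/asboolP; exists j.
exact: orbit_refl.
Qed.

Lemma orbit_repP tb : exists k, tb == map (shift k) (orbit_rep tb).
Proof.
have /asboolP[j E] := chooseP (orbit_refl tb).
by have [k Ek] := map_shift_inv j tb; exists k; rewrite /orbit_rep E Ek.
Qed.

(* The phase of a tuple, equivariant under shifts; on coherent tuples it has to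
   be the common index. *)
Definition phase tb : nat :=
  if pselect (exists k, all_coherent k tb) then common_index tb else xchoose (orbit_repP tb).

Lemma phase_coherent k tb : all_coherent k tb -> phase tb = k %[mod lcmv tb].
Proof.
rewrite /phase => H; case: pselect => [? |[]]; last by exists k.
exact: all_coherent_uniq (common_indexP H) H.
Qed.

(** Coherence is constant on orbits. For coherent tuples the common index moves with the shift. For
    the others the phase is the displacement from the shared representative, which is determined
    modulo the lcm. *)
Lemma phase_shift j tb : phase (map (shift j) tb) = (phase tb + j)%N %[mod lcmv tb].
Proof.
have [[k H]|N] := pselect (exists k, all_coherent k tb).
  rewrite -(lcmv_shift j) (phase_coherent (all_coherent_shift j H)) lcmv_shift.
  by rewrite -modnDml -(phase_coherent H) modnDml.
rewrite /phase; case: pselect => [[k H]|?].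
  case: N; have [j' <-] := map_shift_inv j tb.
  by exists (k + j')%N; apply: all_coherent_shift.
case: pselect => // ?.
have := xchooseP (orbit_repP tb); move: (xchoose (orbit_repP tb)) => b /eqP Eb.
have := xchooseP (orbit_repP (map (shift j) tb)).
move: (xchoose (orbit_repP (map (shift j) tb))) => a /eqP Ea; rewrite orbit_rep_shift in Ea.
have : map (shift a) (orbit_rep tb) = map (shift (b + j)) (orbit_rep tb).
  by rewrite -Ea -map_shift_add -Eb.
by move/map_shift_inj_mod; rewrite -(lcmv_shift b (orbit_rep tb)) -Eb; apply.
Qed.

(** The index of [s] matters modulo its multiplicity and the phase of [tb] modulo [lcmv tb], so they
    are compared modulo the gcd. The empty tuple carries no condition. *)
Definition linked vs : bool :=
  if split_last vs is Some (tb, s)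
  then idx s == phase tb %[mod gcdn (lcmv tb) (mulv (proj s))] else true.

Lemma split_last_rcons (A : Type) (s : seq A) x : split_last (rcons s x) = Some (s, x).
Proof. by elim: s => //= y s ->. Qed.

Lemma split_lastP (A : Type) (s tb : seq A) x :
  split_last s = Some (tb, x) -> s = rcons tb x.
Proof.
case: (lastP s) => // s' y; rewrite split_last_rcons.
by case=> -> ->.
Qed.

(** The phase of the initial part and the index of the last component are both congruent to [k]. *)
Lemma linked_coherent k vs : all_coherent k vs -> linked vs.
Proof.
case: (lastP vs) => // tb s; rewrite /linked split_last_rcons.
rewrite /all_coherent all_rcons => /andP[/eqP Es H].
rewrite eq_sym; apply/eqP; transitivity (k %% gcdn (lcmv tb) (mulv (proj s)))%N.
  exact: modn_dvd (dvdn_gcdl _ _) (phase_coherent H).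
by rewrite Es modn_dvdm ?dvdn_gcdr.
Qed.

(** A single element is coherent with its own index, so the phase of [[:: v]] is [idx v], and over
    equal projections the gcd is the full multiplicity. Equations thereby behave like atoms of a
    relation symbol. *)
Lemma linked_eq v w : v = w <-> proj v = proj w /\ linked [:: v; w].
Proof.
have coh1 : all_coherent (idx v) [:: v].
  by rewrite /all_coherent /= /coherent modn_small ?idx_lt ?eqxx.
split=> [<-|[E]].
  split=> //; apply: (@linked_coherent (idx v)).
  by move: coh1; rewrite /all_coherent /= !andbT => ->.
have := phase_coherent coh1; rewrite /linked /= /lcmv /lcms /= big_seq1 E gcdnn => -> /eqP.
rewrite !modn_small ?idx_lt // -?E ?idx_lt // => Ei.
exact: cval_inj.
Qed.

End Blowup.

(** * Case analysis of the translation, its free variables and its types *)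

Section Views.
Variable V : vocab.
Local Notation lterm := (term (lifted V)).
Local Notation lform := (formula (lifted V)).
Local Notation catm F ts := (flatten (map F ts)).

Definition chi_atom (p : predicate V) (ts : seq (term V)) : lform :=
  FAtom (lift_pred p) (map (@chi_term V) ts).

(** The translation and its constraints are analysed together, by the rule that applied rather than
    by the shape of the body, which leaves two cases. *)
Variant sum_view (t : term V) xs : formula V -> lterm -> seq lform -> Prop :=
  | SumSpecial p ts psi of special xs ts :
      sum_view t xs (FAnd (FAtom p ts) psi)
        (@TSum (lifted V)
           (tmul (special_factor xs (map (@chi_term V) ts)) (chi_term t)) xs
           (FAnd (pos_mul xs) (FAnd (chi_atom p ts) (chi_form psi))))
        (reg_term t ++ catm (@reg_term V) ts ++ reg_form psi)
  | SumGeneral a :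
      sum_view t xs a
        (@TSum (lifted V) (tmul (Mulv xs) (chi_term t)) xs
           (FAnd (pos_mul xs) (chi_form a)))
        (reg_term t ++ reg_form a).

Lemma sum_viewP t xs a :
  sum_view t xs a (chi_term (TSum t xs a)) (reg_term (TSum t xs a)).
Proof.
rewrite /=; case: a; try by move=> *; apply: SumGeneral.
by case=> *; try exact: SumGeneral; case: ifP => *; [apply: SumSpecial | apply: SumGeneral].
Qed.

Variant all_view xs : formula V -> lform -> seq lform -> Prop :=
  | AllSpecial p ts psi of special xs ts :
      all_view xs (FImp (FAtom p ts) psi)
        (@FAll (lifted V) xs
           (FImp (FAnd (pos_mul xs) (chi_atom p ts)) (chi_form psi)))
        (catm (@reg_term V) ts ++ reg_form psi)
  | AllGeneral a :
      all_view xs a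
        (@FAll (lifted V) xs (FImp (pos_mul xs) (chi_form a))) (reg_form a).

Lemma all_viewP xs a : all_view xs a (chi_form (FAll xs a)) (reg_form (FAll xs a)).
Proof.
rewrite /=; case: a; try by move=> *; apply: AllGeneral.
by case=> *; try exact: AllGeneral; case: ifP => *; [apply: AllSpecial | apply: AllGeneral].
Qed.

Variant ex_view xs : formula V -> lform -> seq lform -> Prop :=
  | ExSpecial p ts psi of special xs ts :
      ex_view xs (FAnd (FAtom p ts) psi)
        (@FEx (lifted V) xs
           (FAnd (pos_mul xs) (FAnd (chi_atom p ts) (chi_form psi))))
        (catm (@reg_term V) ts ++ reg_form psi)
  | ExGeneral a :
      ex_view xs a
        (@FEx (lifted V) xs (FAnd (pos_mul xs) (chi_form a))) (reg_form a).

Lemma ex_viewP xs a : ex_view xs a (chi_form (FEx xs a)) (reg_form (FEx xs a)).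
Proof.
rewrite /=; case: a; try by move=> *; apply: ExGeneral.
by case=> *; try exact: ExGeneral; case: ifP => *; [apply: ExSpecial | apply: ExGeneral].
Qed.

Lemma specialP xs (ts : seq (term V)) : special xs ts ->
  exists tb s, [/\ ts = rcons tb s,
    {in tb, forall t, {subset fv_term t <= xs}} &
    {in fv_term s, forall y, y \notin xs}].
Proof.
rewrite /special; case E: (split_last ts) => [[tb s]|//] /andP[/allP Htb /hasPn Hs].
exists tb, s; split; first exact: split_lastP.
  by move=> t ttb y yt; apply: Htb; apply/flatten_mapP; exists t.
by move=> y /Hs.
Qed.

Lemma special_factor_rcons xs (us : seq lterm) u :
  special_factor xs (rcons us u) =
  tdiv (tmul (Mulv xs) (Lcm (rcons us u))) (tmul (Lcm us) (mul_of u)).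
Proof. by rewrite /special_factor split_last_rcons. Qed.

Lemma fv_mul_of (u : lterm) : {subset fv_term (mul_of u) <= fv_term u}.
Proof. by rewrite /mul_of => y; case: (ty_of u) => //= s; rewrite cats0. Qed.

Lemma fv_Mul (us : seq lterm) :
  {subset fv_term (Mul us) <= catm (@fv_term (lifted V)) us}.
Proof.
move=> y; rewrite /Mul; elim: us => //= u us IH; rewrite !mem_cat.
by move=> /orP[/fv_mul_of ->//|/IH ->]; rewrite orbT.
Qed.

Lemma fv_Lcm (us : seq lterm) :
  {subset fv_term (Lcm us) <= catm (@fv_term (lifted V)) us}.
Proof.
move=> y; rewrite /Lcm /=; elim: us => //= u us IH; rewrite !mem_cat.
by move=> /orP[/fv_mul_of ->//|/IH ->]; rewrite orbT.
Qed.

Lemma fv_Mulv (xs : seq (var V)) : {subset (fv_term (Mulv xs) : seq (var V)) <= xs}.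
Proof.
by move=> y /fv_Mul /flatten_mapP[u /mapP[x xxs ->]]; rewrite inE => /eqP ->.
Qed.

Lemma fv_special_factor xs us :
  {subset (fv_term (special_factor xs us) : seq (var V)) <=
     xs ++ (catm (@fv_term (lifted V)) us : seq (var V))}.
Proof.
move=> y; case: (lastP us) => [//|us' u]; rewrite special_factor_rcons.
have E : catm (@fv_term (lifted V)) (rcons us' u) =
    catm (@fv_term (lifted V)) us' ++ fv_term u.
  by rewrite map_rcons -cats1 flatten_cat /= cats0.
rewrite -[fv_term _]/((fv_term (Mulv xs) ++ fv_term (Lcm (rcons us' u))) ++
  (fv_term (Lcm us') ++ fv_term (mul_of u))).
rewrite E !mem_cat.
case/orP; case/orP.
- by move/fv_Mulv => ->.
- by move/fv_Lcm; rewrite E mem_cat => ->; rewrite orbT.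
- by move/fv_Lcm => ->; rewrite orbT.
- by move/fv_mul_of => ->; rewrite !orbT.
Qed.

(** The added guards and factors contain only variables of the binder, which it removes, and
    variables of the absorbed atom. *)
Lemma fv_chi :
  (forall t : term V, {subset (fv_term (chi_term t) : seq (var V)) <= fv_term t}) /\
  (forall a : formula V, {subset (fv_form (chi_form a) : seq (var V)) <= fv_form a}).
Proof.
have args (ts : seq (term V)) :
    {in ts, forall t, {subset (fv_term (chi_term t) : seq (var V)) <= fv_term t}} ->
    {subset (catm (@fv_term (lifted V)) (map (@chi_term V) ts) : seq (var V))
       <= catm (@fv_term V) ts}.
  move=> IH y /flatten_mapP[u /mapP[t tts ->]] /(IH t tts) yt.
  by apply/flatten_mapP; exists t.
have cat2 (A B A' B' : seq (var V)) :
    {subset A <= A'} -> {subset B <= B'} -> {subset A ++ B <= A' ++ B'}.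
  by move=> HA HB y; rewrite !mem_cat => /orP[/HA ->//|/HB ->]; rewrite orbT.
have filt (xs A A' : seq (var V)) : {subset A <= xs ++ A'} ->
    {subset [seq y <- A | y \notin xs] <= [seq y <- A' | y \notin xs]}.
  move=> H y; rewrite !mem_filter => /andP[yxs /H].
  by rewrite mem_cat (negbTE yxs).
apply: guarded_ind => //.
- by move=> x y H; exact: H.
- by move=> o t1 t2 /= H1 H2; apply: cat2.
- move=> t xs a; case: sum_viewP => [p ts psi _|{}a] /= Ht Ha.
    move=> [IH Hpsi]; have Hts := args _ IH; apply: (filt xs) => y.
    rewrite !mem_cat => /orP[/orP[/fv_special_factor|/Ht ->]|/orP[/fv_Mulv ->//|/orP[]]].
    + by rewrite mem_cat => /orP[->//|/Hts ->]; rewrite !orbT.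
    + by rewrite !orbT.
    + by move/Hts => ->; rewrite !orbT.
    + by move/Hpsi => ->; rewrite !orbT.
  move=> _; apply: (filt xs) => y.
  rewrite !mem_cat => /orP[/orP[/fv_Mulv ->//|/Ht ->]|/orP[/fv_Mulv ->//|/Ha ->]];
    by rewrite ?orbT.
- by move=> c t1 t2 /= H1 H2; apply: cat2.
- by move=> T n y; rewrite /= mem_head cats0.
- by move=> a b /= H1 H2; apply: cat2.
- by move=> a b /= H1 H2; apply: cat2.
- by move=> a b /= H1 H2; apply: cat2.
- by move=> a b /= H1 H2; apply: cat2.
- move=> xs a; case: all_viewP => [p ts psi _|{}a] /= Ha.
    move=> [IH Hpsi]; have Hts := args _ IH; apply: (filt xs) => y.
    rewrite !mem_cat => /orP[/orP[/fv_Mulv ->//|/Hts ->]|/Hpsi ->];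
      by rewrite ?orbT.
  move=> _; apply: (filt xs) => y.
  by rewrite !mem_cat => /orP[/fv_Mulv ->//|/Ha ->]; rewrite orbT.
- move=> xs a; case: ex_viewP => [p ts psi _|{}a] /= Ha.
    move=> [IH Hpsi]; have Hts := args _ IH; apply: (filt xs) => y.
    rewrite !mem_cat => /orP[/fv_Mulv ->//|/orP[/Hts ->|/Hpsi ->]];
      by rewrite ?orbT.
  move=> _; apply: (filt xs) => y.
  by rewrite !mem_cat => /orP[/fv_Mulv ->//|/Ha ->]; rewrite orbT.
Qed.

(** Types are preserved only up to their type symbol: the quotient in a special factor can turn an
    aggregate of type [TyNat] into one of type [TyRat]. Multiplicity terms depend on the symbol
    alone. *)
Lemma ty_sym_chi (t : term V) : ty_sym (ty_of (chi_term t)) = ty_sym (ty_of t).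
Proof.
case: t => // [o t1 t2|t xs a]; first by case: o => //=; do 2 case: ifP.
by case: sum_viewP => *; rewrite [ty_of]lock /= -lock /= !(fun_if (@ty_sym _)) !if_same.
Qed.

End Views.

(** * Evaluation respects types *)

Section Typing.
Variables (V : vocab) (M : structure V).

Lemma has_ty_subty (v : elem M) T U : has_ty v T -> subty T U -> has_ty v U.
Proof.
move=> vT /orP[/eqP <-//|/andP[/eqP ET /eqP EU]].
by move: vT; rewrite ET EU; case: v.
Qed.

Lemma num_of_nat (v : elem M) : has_ty v TyNat -> num_of v \is a Num.nat.
Proof. by case: v. Qed.

Lemma has_ty_args (e : env M) ts Ts :
  {in ts, forall t, has_ty (eval e t) (ty_of t)} -> wf_args ts Ts ->
  all2 (@has_ty _ (dom M)) (map (eval e) ts) Ts.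
Proof.
rewrite /wf_args; elim: ts Ts => [|t ts IH] [|T Ts] //= H /andP[sT /IH ->].
  by rewrite andbT; apply: has_ty_subty sT; apply: H; rewrite mem_head.
by move=> u uts; apply: H; rewrite inE uts orbT.
Qed.

Lemma typed_on_env xs fvs (e e' : env M) :
  typed_on [seq y <- fvs | y \notin xs] e ->
  agree_off xs e e' -> typed_on xs e' -> typed_on fvs e'.
Proof.
move=> He Ha Hx y yf; have [/Hx//|yxs] := boolP (y \in xs).
by rewrite Ha //; apply: He; rewrite mem_filter yxs.
Qed.

Lemma typed_on_sub xs ys (e : env M) :
  {subset xs <= ys} -> typed_on ys e -> typed_on xs e.
Proof. by move=> sub H y /sub /H. Qed.

Lemma typed_on_arg ts (e : env M) :
  typed_on (flatten (map (@fv_term V) ts)) e ->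
  {in ts, forall t, typed_on (fv_term t) e}.
Proof. by move=> H t tts; apply: typed_on_sub H => y yt; apply/flatten_mapP; exists t. Qed.

Lemma eval_has_ty t (e : env M) :
  wf_term t -> typed_on (fv_term t) e -> has_ty (eval e t) (ty_of t).
Proof.
pose P t := forall e : env M, wf_term t -> typed_on (fv_term t) e ->
  has_ty (eval e t) (ty_of t).
(* Formulas get a trivial predicate: the condition of an aggregate selects summands but does not
   affect their type. *)
suff [H _] : (forall t, P t) /\ (forall a : formula V, True) by apply: H.
apply: plain_ind => {t e} //; rewrite /P /=.
- by move=> x e _; apply; rewrite mem_head.
- by move=> q e _ _ /=; case: ifP.
- move=> f ts IH e /andP[wfa /allP wfts] He; apply: fint_ty; apply: has_ty_args wfa.
  by move=> t tts; apply: IH => //; [exact: wfts | exact: typed_on_arg He t tts].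
- move=> o t1 t2 IH1 IH2 e /and4P[_ _ w1 w2] He.
  have {IH1}H1 : has_ty (eval e t1) (ty_of t1).
    by apply: IH1 => //; apply: typed_on_sub He => y; rewrite mem_cat => ->.
  have {IH2}H2 : has_ty (eval e t2) (ty_of t2).
    by apply: IH2 => //; apply: typed_on_sub He => y; rewrite mem_cat => ->; rewrite orbT.
  case: o => //=; case: ifP => // /andP[/eqP E1 /eqP E2];
    rewrite E1 in H1; rewrite E2 in H2.
    by rewrite rpredD // num_of_nat.
  by rewrite rpredM // num_of_nat.
- move=> t xs a IH _ e /and4P[_ _ wt _] He; case: ifP => // /eqP ET /=.
  rewrite big_mkcond big_seq; apply: rpred_sum => e' /envs_agree[Ha Hx].
  case: ifP => // _; apply: num_of_nat; rewrite -ET; apply: IH => //.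
  apply: typed_on_env Ha Hx; apply: typed_on_sub He => y.
  by rewrite !mem_filter mem_cat => /andP[-> ->].
Qed.

End Typing.

(** * The concrete structure and sums over its assignments *)

Section Concretization.
Variables (V : vocab) (L : structure (lifted V)).
Local Notation mulv := (@mulv V L).
Local Notation cval := (@cval V L).
Local Notation cdom := (@cdom V L).
Implicit Types (f : Defs.fsym V) (vs : seq cval).

(** A common index can be missing only for ill-typed arguments, where the interpretation is
    irrelevant. *)
Definition cfint f vs : cval :=
  at_idx (fint (s := L) (inl f) (map (@proj V L) vs)) (common_index vs).

Definition cpint (p : psym V) vs : bool :=
  pint (s := L) p (map (@proj V L) vs) && linked vs.

(** Arithmetic content of the two constraints on function symbols. The first makes every well-typed
    concrete argument tuple coherent; the second makes the index of the value independent of the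
    choice of the common index. *)
Hypothesis coprime_dom : forall f (ws : seq (elem L)),
  all2 (@has_ty _ (dom L)) ws (fdom f) -> prods (map mulv ws) = lcms (map mulv ws).
Hypothesis dvd_cod : forall f (ws : seq (elem L)),
  all2 (@has_ty _ (dom L)) ws (fdom f) ->
  (mulv (fint (s := L) (inl f) ws) %| prods (map mulv ws))%N.

Lemma has_ty_map_proj vs Ts :
  all2 (@has_ty _ (dom L)) (map (@proj V L) vs) Ts = all2 (@has_ty _ cdom) vs Ts.
Proof. by elim: vs Ts => [|v vs IH] [|T Ts] //=; rewrite IH has_ty_proj. Qed.

Section Application.
Variables (f : Defs.fsym V) (vs : seq cval).
Hypothesis vsT : all2 (@has_ty _ cdom) vs (fdom f).

Lemma prods_args : prods (map (mulv \o @proj V L) vs) = lcmv vs.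
Proof.
by rewrite /lcmv map_comp; apply: (@coprime_dom f); rewrite has_ty_map_proj.
Qed.

Lemma dvd_app : (mulv (fint (s := L) (inl f) (map (@proj V L) vs)) %| lcmv vs)%N.
Proof. by rewrite -prods_args map_comp; apply: dvd_cod; rewrite has_ty_map_proj. Qed.

(** A divisor of a positive number is positive, so the lifted value at concrete arguments does have
    a concrete copy. *)
Lemma mulv_app_gt0 : (0 < mulv (fint (s := L) (inl f) (map (@proj V L) vs)))%N.
Proof. exact: dvdn_gt0 (lcmv_gt0 vs) dvd_app. Qed.

Lemma proj_app : proj (cfint f vs) = fint (s := L) (inl f) (map (@proj V L) vs).
Proof. by rewrite proj_at_idx // mulv_app_gt0. Qed.

Lemma coherent_app k : all_coherent k vs -> coherent k (cfint f vs).
Proof.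
move=> H; rewrite (@coherent_eqmod _ _ k (common_index vs)) ?coherent_at_idx ?mulv_app_gt0 //.
rewrite proj_app; apply: modn_dvd dvd_app _.
exact: all_coherent_uniq H (common_indexP H).
Qed.

Lemma all_coherent_args : exists k, all_coherent k vs.
Proof. exact: all_coherent_ex prods_args. Qed.
End Application.

Lemma cfint_ty f vs :
  all2 (@has_ty _ cdom) vs (fdom f) -> has_ty (cfint f vs) (fcod f).
Proof.
move=> vsT; rewrite -has_ty_proj proj_app //.
by apply: (@fint_ty _ L (inl f)); rewrite has_ty_map_proj.
Qed.

Lemma map_proj_shift j vs : map (@proj V L) (map (shift j) vs) = map (@proj V L) vs.
Proof. by rewrite -map_comp; apply/eq_map => v /=; rewrite proj_shift. Qed.

Lemma has_ty_map_shift j vs Ts :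
  all2 (@has_ty _ cdom) (map (shift j) vs) Ts = all2 (@has_ty _ cdom) vs Ts.
Proof. by rewrite -has_ty_map_proj map_proj_shift has_ty_map_proj. Qed.

(** If the arguments are [k]-coherent, both sides are [(k + j)]-coherent copies of the same lifted
    element. *)
Lemma app_shift f j vs : all2 (@has_ty _ cdom) vs (fdom f) ->
  cfint f (map (shift j) vs) = shift j (cfint f vs).
Proof.
move=> vsT; have vsT' := vsT; rewrite -(has_ty_map_shift j) in vsT'.
have [k H] := all_coherent_args vsT.
rewrite (coherentE (coherent_app vsT' (all_coherent_shift j H))) (coherentE (coherent_shift j (coherent_app vsT H))).
by rewrite proj_shift !proj_app // map_proj_shift.
Qed.

Definition concretization : structure V :=
  @Structure V cdom cfint cpint cfint_ty.
Local Notation I := concretization.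
Local Notation "'⌊' e '⌋'" := ((@proj V L \o e) : env L) (format "'⌊' e '⌋'").

Lemma num_of_proj (v : elem I) : @num_of _ L (proj v) = @num_of _ I v.
Proof. by case: v. Qed.

Lemma card_cdom T : #|cdom T|%:R = \sum_(d : dom L T) mul_elt d :> rat.
Proof.
rewrite /cdom card_tagged sumnE big_map -big_enum natr_sum; apply: eq_bigr => d _.
by rewrite card_ord /mul_elt fint_mul.
Qed.

Lemma typed_proj (xs : seq (var V)) (e : env I) :
  @typed_on (lifted V) L xs ⌊e⌋ <-> typed_on xs e.
Proof. by split=> H y /H; rewrite /= has_ty_proj. Qed.

Lemma proj_upd (e : env I) x v : ⌊upd e x v⌋ = upd ⌊e⌋ x (proj v).
Proof. by apply/funext => y; rewrite /upd /=; case: ifP. Qed.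

(** The fibre of [proj] over [w] has [mulv w] elements. *)
Lemma sum_enum_proj T (G : elem L -> rat) : is_fin T ->
  \sum_(v <- enum_ty I T) G (proj v) =
  \sum_(w <- enum_ty (V := lifted V) L T) (mulv w)%:R * G w.
Proof.
case: T => //= [|s] _; first by rewrite !big_cons !big_nil /= !mul1r.
rewrite big_map big_enum [RHS]big_map [RHS]big_enum /=.
rewrite -(@sig_big_dep _ _ _ _ _ predT (fun=> predT)
  (fun d (i : 'I_(mulv (VElt s d))) => G (VElt s d))) /=.
by apply: eq_bigr => d _; rewrite sumr_const card_ord mulr_natl.
Qed.

Definition mul_vars (xs : seq (var V)) (ε : env L) : nat := prods (map (mulv \o ε) xs).

(** The fibre count is iterated over the binder, so the concrete assignments over [ε] number
    [mul_vars xs ε]. Distinctness of the variables ensures that the value bound to [x] survives the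
    inner binders. *)
Lemma sum_envs_proj (xs : seq (var V)) (e : env I) (Q : env L -> rat) : wf_binder xs ->
  \sum_(e' <- envs xs e) Q ⌊e'⌋ =
  \sum_(ε <- envs (V := lifted V) xs ⌊e⌋) (mul_vars xs ε)%:R * Q ε.
Proof.
move=> /andP[]; elim: xs e => [|x xs IH] e.
  by rewrite /= !big_seq1 /mul_vars /prods big_nil mul1r.
move=> /= /andP[xxs uxs] /andP[xfin xsfin].
rewrite sum_envs_cons (@sum_envs_cons (lifted V) L).
pose G w := \sum_(ε <- envs (V := lifted V) xs (upd ⌊e⌋ x w)) (mul_vars xs ε)%:R * Q ε.
transitivity (\sum_(v <- enum_ty I x.2) G (proj v)).
  by apply: eq_bigr => v _; rewrite IH // proj_upd.
rewrite sum_enum_proj //; apply: eq_bigr => w _.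
rewrite /G big_distrr /=; apply: eq_big_seq => ε /envs_agree[Ha _].
have [_ Ex] := @agree_off_upd (lifted V) L _ _ _ _ _ xxs Ha.
by rewrite mulrA -natrM /mul_vars /prods /= big_cons Ex.
Qed.

(** Each variable has its own shift, because bound variables are to move while the remaining ones
    stay fixed. *)
Definition shift_env (κ : var V -> nat) (e : env I) : env I := fun y => shift (κ y) (e y).

Lemma proj_shift_env κ e : ⌊shift_env κ e⌋ = ⌊e⌋.
Proof. by apply/funext => y; rewrite /= proj_shift. Qed.

Lemma shift_env_upd κ e x v : shift_env κ (upd e x v) = upd (shift_env κ e) x (shift (κ x) v).
Proof. by apply/funext => y; rewrite /shift_env /upd; case: eqP => // ->. Qed.

Lemma enum_ty_uniq T : uniq (enum_ty I T).
Proof.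
case: T => // [|s]; first by rewrite /= inE andbT; apply/eqP.
rewrite map_inj_uniq ?enum_uniq // => d1 d2 E.
(* Passing to a sigma type over the type symbols, whose equality is decidable, gives injectivity of
   [VElt s] in its dependent argument. *)
pose g (v : elem I) : option {s : tsym V & cdom s} :=
  if v is VElt s d then Some (Tagged cdom d) else None.
have [/eqP] : Some (Tagged cdom d1) = Some (Tagged cdom d2) by exact: (congr1 g E).
by rewrite eq_Tagged => /eqP.
Qed.

Lemma mem_enum_tyE v T : is_fin T -> (v \in enum_ty I T) = has_ty v T.
Proof.
move=> fT; apply/idP/idP; first exact: mem_enum_ty.
case: T fT => // [|s] _; case: v => //=.
  by case=> _; rewrite !inE eqxx ?orbT.
by move=> s' d /eqP E; subst s'; apply/mapP; exists d => //; rewrite mem_enum.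
Qed.

Lemma perm_enum_shift T j : perm_eq (map (shift j) (enum_ty I T)) (enum_ty I T).
Proof.
have [fT|] := boolP (is_fin T); last by case: T.
apply: uniq_perm; rewrite ?enum_ty_uniq //.
  rewrite map_inj_uniq ?enum_ty_uniq // => v1 v2 E.
  have [j1] := map_shift_inv j [:: v1]; rewrite /= E => -[E1].
  have Ep : proj v1 = proj v2 by have := congr1 (@proj V L) E; rewrite !proj_shift.
  apply: cval_inj => //.
  have := congr1 (@idx V L) E; rewrite !idx_shift Ep => /eqP.
  by rewrite eqn_modDr -{1}Ep !modn_small ?idx_lt // => /eqP.
move=> v; rewrite mem_enum_tyE //; apply/mapP/idP => [[u + ->]|vT].
  by rewrite mem_enum_tyE // => uT; rewrite -has_ty_proj proj_shift has_ty_proj.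
have [j1] := map_shift_inv j [:: v]; rewrite /= shift_add addnC => -[E1].
exists (shift j1 v); last by rewrite shift_add.
by rewrite mem_enum_tyE // -has_ty_proj proj_shift has_ty_proj.
Qed.

Lemma sum_envs_shift_env κ xs e (F : env I -> rat) :
  \sum_(e' <- envs xs e) F (shift_env κ e') = \sum_(e' <- envs xs (shift_env κ e)) F e'.
Proof.
elim: xs e => [|x xs IH] e; first by rewrite /= !big_seq1.
rewrite !sum_envs_cons -[RHS](perm_big _ (perm_enum_shift x.2 (κ x))) big_map.
by apply: eq_bigr => v _; rewrite IH shift_env_upd.
Qed.

Definition offset_on (xs : seq (var V)) j : var V -> nat := fun y => if y \in xs then j else 0%N.

Lemma shift_env_off xs j e y : y \notin xs -> shift_env (offset_on xs j) e y = e y.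
Proof. by move=> /negbTE H; rewrite /shift_env /offset_on H shift0. Qed.

Lemma sum_envs_offset_on xs j e (F : env I -> rat) :
  \sum_(e' <- envs xs e) F (shift_env (offset_on xs j) e') = \sum_(e' <- envs xs e) F e'.
Proof.
rewrite sum_envs_shift_env; apply: (@sum_envs_rel _ _ predT) => [y _ yxs|e1 e2 E].
  exact: shift_env_off.
by congr F; apply/funext => y; apply: E.
Qed.

(* By averaging over the shifts of the bound variables, under which [h] takes
   each residue modulo [g e'] equally often. *)
Lemma sum_envs_phase xs e (m : nat) (g h : env I -> nat) (a : nat) (Q : env I -> rat) :
  (0 < m)%N ->
  (forall e', e' \in envs xs e -> [/\ (g e' %| m)%N,
     forall j, Q (shift_env (offset_on xs j) e') = Q e',
     forall j, g (shift_env (offset_on xs j) e') = g e' &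
     forall j, h (shift_env (offset_on xs j) e') = (h e' + j)%N %[mod g e']]) ->
  \sum_(e' <- envs xs e) (if a == h e' %[mod g e'] then Q e' else 0) =
  \sum_(e' <- envs xs e) Q e' / (g e')%:R.
Proof.
move=> m0 H; pose F e' := if a == h e' %[mod g e'] then Q e' else 0.
have m0' : m%:R != 0 :> rat by rewrite pnatr_eq0 -lt0n.
apply: (mulfI m0').
(* After multiplication by [m], a common multiple of the moduli, the sum is repeated over [m]
   shifts, each of which permutes the assignments. For fixed [e'] the condition then holds for
   [m / g e'] of the shifts. *)
transitivity (\sum_(j < m) \sum_(e' <- envs xs e) F (shift_env (offset_on xs j) e')).
  rewrite [RHS](eq_bigr (fun=> \sum_(e' <- envs xs e) F e')) => [|j _];
    last exact: (sum_envs_offset_on xs j e F).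
  by rewrite sumr_const card_ord mulr_natl.
rewrite exchange_big big_distrr /=; apply: eq_big_seq => e' /H[gm HQ Hg Hh].
have [q Em] : exists q, m = (q * g e')%N by apply/dvdnP.
have g0 : (0 < g e')%N by apply: dvdn_gt0 gm.
rewrite /F (eq_bigr (fun j : 'I_m => Q e' * (a == h e' + j %[mod g e'])%N%:R)).
  rewrite -big_distrr -natr_sum /=.
  have -> : (\sum_(j < m) (a == h e' + j %[mod g e']))%N = q.
    by rewrite Em sum_shift_eqmod.
  rewrite Em natrM.
  rewrite mulrC -mulrA; congr (_ * _).
  by rewrite mulrC mulfVK // pnatr_eq0 -lt0n.
by move=> j _; rewrite HQ Hg Hh; case: ifP; rewrite ?mulr1 ?mulr0.
Qed.

End Concretization.

(** * The translation is true in the lifted structure exactly when the source is true in the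
    concrete one *)

Section Correctness.
Variables (V : vocab) (L : structure (lifted V)).
Local Notation mulv := (@mulv V L).
Local Notation cdom := (@cdom V L).
Hypothesis coprime_dom : forall (f : Defs.fsym V) (ws : seq (elem L)),
  all2 (@has_ty _ (dom L)) ws (fdom f) -> prods (map mulv ws) = lcms (map mulv ws).
Hypothesis dvd_cod : forall (f : Defs.fsym V) (ws : seq (elem L)),
  all2 (@has_ty _ (dom L)) ws (fdom f) ->
  (mulv (fint (s := L) (inl f) ws) %| prods (map mulv ws))%N.
Local Notation I := (concretization coprime_dom dvd_cod).
Local Notation "'⌊' e '⌋'" := ((@proj V L \o e) : env L) (format "'⌊' e '⌋'").
Local Notation fvs ts := (flatten (map (@fv_term V) ts)).

Definition regular (rs : seq (formula (lifted V))) : Prop :=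
  {in rs, forall r, models L r}.

Lemma regular_cat rs1 rs2 : regular (rs1 ++ rs2) <-> regular rs1 /\ regular rs2.
Proof.
split=> [H|[H1 H2] r]; last by rewrite mem_cat => /orP[/H1|/H2].
by split=> r rr; apply: H; rewrite mem_cat rr ?orbT.
Qed.

Lemma regular_flatten (A : eqType) (F : A -> seq (formula (lifted V))) ts :
  regular (flatten (map F ts)) -> {in ts, forall t, regular (F t)}.
Proof. by move=> H t tts r rt; apply: H; apply/flatten_mapP; exists t. Qed.

(** The first property is correctness proper. Equivariance serves the special rules, where bound
    variables are shifted. Coherence serves the atom rule, where a constraint can make the
    assignment coherent on the variables of the translated atom. *)
Definition term_ok (t : term V) : Prop :=
  wf_term t -> regular (reg_term t) ->
  forall e : env I, typed_on (fv_term t) e ->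
  [/\ eval ⌊e⌋ (chi_term t) = proj (eval e t),
      forall κ j, {in fv_term t, forall y, κ y = j} ->
        eval (shift_env κ e) t = shift j (eval e t) &
      forall k, {in (fv_term (chi_term t) : seq (var V)), forall y, coherent k (e y)} ->
        coherent k (eval e t)].

Definition form_ok (a : formula V) : Prop :=
  wf_form a -> regular (reg_form a) ->
  forall e : env I, typed_on (fv_form a) e -> sat ⌊e⌋ (chi_form a) <-> sat e a.

Lemma typed_shift_env xs κ (e : env I) : typed_on xs e -> typed_on xs (shift_env κ e).
Proof. by move=> H y /H; rewrite -!has_ty_proj /shift_env proj_shift. Qed.

(** Numbers are fixed by shifts and coherent with every integer. Equivariance then follows from
    correctness, because a shifted assignment has the same projection. *)
Lemma numeric_ok (t : term V) :
  (forall e : env I, exists q, eval e t = VNum q) ->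
  (forall e : env I, typed_on (fv_term t) e ->
     eval ⌊e⌋ (chi_term t) = proj (eval e t)) ->
  forall e : env I, typed_on (fv_term t) e ->
  [/\ eval ⌊e⌋ (chi_term t) = proj (eval e t),
      forall κ j, {in fv_term t, forall y, κ y = j} ->
        eval (shift_env κ e) t = shift j (eval e t) &
      forall k, {in (fv_term (chi_term t) : seq (var V)), forall y, coherent k (e y)} ->
        coherent k (eval e t)].
Proof.
move=> num A e He; split; first exact: A.
  move=> κ j _; have := A _ (typed_shift_env κ He); rewrite proj_shift_env A //.
  by have [q ->] := num e; have [q' ->] := num (shift_env κ e) => -[->].
by move=> k _; have [q ->] := num e; rewrite /coherent /= modn1.
Qed.

Section Arguments.
Variables (ts : seq (term V)) (e : env I).
Hypothesis ts_ok : {in ts, forall t, term_ok t}.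
Hypothesis ts_wf : all (@wf_term V) ts.
Hypothesis ts_reg : regular (flatten (map (@reg_term V) ts)).
Hypothesis ts_typed : typed_on (fvs ts) e.
Let vs : seq (cval L) := map (eval e) ts.

Let arg_ok t : t \in ts -> _ := fun tts =>
  ts_ok tts (allP ts_wf t tts) (regular_flatten ts_reg tts) (typed_on_arg ts_typed tts).

Lemma args_proj : map (eval ⌊e⌋) (map (@chi_term V) ts) = map (@proj V L) vs.
Proof. by rewrite -!map_comp; apply/eq_in_map => t /arg_ok[]. Qed.

Lemma args_shift κ j : {in fvs ts, forall y, κ y = j} ->
  map (eval (shift_env κ e)) ts = map (shift j) vs.
Proof.
move=> H; rewrite -map_comp; apply/eq_in_map => t tts /=.
have [_ + _] := arg_ok tts; apply=> y yt; apply: H.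
by apply/flatten_mapP; exists t.
Qed.

Lemma args_coherent k :
  {in (fv_form (FAtom PEq (map (@chi_term V) ts)) : seq (var V)), forall y, coherent k (e y)} ->
  all_coherent k vs.
Proof.
move=> H; apply/allP => v /mapP[t tts ->].
have [_ _] := arg_ok tts; apply=> y yt; apply: H.
by apply/flatten_mapP; exists (chi_term t) => //; apply/mapP; exists t.
Qed.

Lemma args_has_ty : {in ts, forall t, has_ty (eval e t) (ty_of t)}.
Proof.
by move=> t tts; apply: eval_has_ty; [exact: (allP ts_wf) | exact: typed_on_arg ts_typed t tts].
Qed.

Lemma args_mul_ok : {in map (@chi_term V) ts, forall u, mul_ok ⌊e⌋ u}.
Proof.
move=> u /mapP[t tts ->]; apply: mul_okP (ty_sym_chi t).
by have [-> _ _] := arg_ok tts; rewrite has_ty_proj args_has_ty.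
Qed.

Lemma args_mulv :
  map (mulv \o eval ⌊e⌋) (map (@chi_term V) ts) = map (mulv \o @proj V L) vs.
Proof. by rewrite map_comp args_proj -map_comp. Qed.

Lemma args_Mul : eval ⌊e⌋ (Mul (map (@chi_term V) ts)) =
  VNum (prods (map (mulv \o @proj V L) vs))%:R.
Proof. by rewrite eval_Mul ?args_mulv //; apply: args_mul_ok. Qed.

Lemma args_Lcm : eval ⌊e⌋ (Lcm (map (@chi_term V) ts)) = VNum (lcmv vs)%:R.
Proof. by rewrite eval_Lcm ?args_mulv //; apply: args_mul_ok. Qed.

Lemma sat_atom p : wf_atom p ts ->
  sat e (FAtom p ts) <-> sat ⌊e⌋ (chi_atom p ts) /\ linked vs.
Proof.
rewrite /= args_proj; case: p => [|p] /= wfp; last first.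
  by split=> /andP.
move: wfp; rewrite /vs; case: (ts) => // t1 [//|t2 [|//]] _ /=.
split=> [/linked_eq[]//|[E H]]; exact/linked_eq.
Qed.

(* The constraint of an atom forces its argument tuple to be coherent: either
   because the assignment is, or because the tuple has coprime multiplicities. *)
Lemma reg_atom_linked p : regular (reg_atom p ts) ->
  sat ⌊e⌋ (chi_atom p ts) -> linked vs.
Proof.
rewrite /reg_atom; case Ets : ts => [|t0 ts0]; first by rewrite /vs Ets.
rewrite -Ets -/(chi_atom p ts) => /(_ _ (mem_head _ _)); set xs : seq (var V) := undup _ => reg Hat.
have xsP : {subset xs <= fvs ts}.
  move=> y; rewrite mem_undup => /flatten_mapP[u /mapP[t tts ->]] /(proj1 (fv_chi V) t) yt.
  by apply/flatten_mapP; exists t.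
have Hx : @typed_on (lifted V) L xs ⌊e⌋.
  by apply/typed_proj; exact: (@typed_on_sub V I xs _ e xsP ts_typed).
(* The constraint is evaluated from the default assignment, so it is instantiated at the assignment
   that follows [e] on [xs] and is the default elsewhere; the terms concerned cannot tell the two
   apart. *)
pose ε : env L := fun y => if y \in xs then proj (e y) else VBool false.
have Eε : {in xs, ε =1 ⌊e⌋} by move=> y yxs; rewrite /ε yxs.
have co (u : term (lifted V)) : {subset (fv_term u : seq (var V)) <= xs} -> eval ε u = eval ⌊e⌋ u.
  by move=> H; apply: (proj1 (coincidence L)) => y /H /Eε.
have coA : sat ε (chi_atom p ts) <-> sat ⌊e⌋ (chi_atom p ts).
  by apply: (proj2 (coincidence L)) => y yt; apply: Eε; rewrite mem_undup.
have subM (u : term (lifted V)) :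
    {subset (fv_term u : seq (var V)) <=
       (flatten (map (@fv_term (lifted V)) (map (@chi_term V) ts)) : seq (var V))} ->
    {subset (fv_term u : seq (var V)) <= xs}.
  by move=> H y /H yt; rewrite mem_undup.
move: reg; rewrite /models sat_FAll => /(_ ε); case.
- by move=> y /negbTE yxs; rewrite /ε yxs.
- by move=> y yxs; rewrite Eε //; apply: Hx.
- exact/coA.
- move=> E; have {E} : eval ε (Mulv xs) = eval ε (Lcmv xs) := E.
  rewrite (co (Mulv xs) (@fv_Mulv _ xs)) (co (Lcmv xs)); last first.
    by move=> y /fv_Lcm /flatten_mapP[u /mapP[x xxs ->]]; rewrite inE => /eqP ->.
  rewrite eval_Mulv // eval_Lcmv // => -[/eqP]; rewrite eqr_nat => /eqP.
  have -> : map (mulv \o ⌊e⌋) xs = map (mulv \o @proj V L) (map e xs) by rewrite -map_comp.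
  move=> /(@all_coherent_ex V L) [k Hk]; apply: (@linked_coherent _ _ k); apply: args_coherent => y yt.
  by apply: (allP Hk); apply: map_f; rewrite mem_undup.
- move=> E.
  have {E} : eval ε (Mul (map (@chi_term V) ts)) = eval ε (Lcm (map (@chi_term V) ts)) := E.
  rewrite !co; [|exact: subM (@fv_Lcm _ _)|exact: subM (@fv_Mul _ _)].
  rewrite args_Mul args_Lcm => -[/eqP]; rewrite eqr_nat => /eqP /all_coherent_ex[k Hk].
  exact: linked_coherent Hk.
Qed.

End Arguments.

Section Special.
Variables (xs : seq (var V)) (tb : seq (term V)) (s : term V) (e : env I).
Local Notation ts := (rcons tb s).
Hypothesis ts_ok : {in ts, forall t, term_ok t}.
Hypothesis ts_wf : all (@wf_term V) ts.
Hypothesis ts_reg : regular (flatten (map (@reg_term V) ts)).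
Hypothesis ts_typed : typed_on (fvs ts) e.
Hypothesis tb_bound : {in tb, forall t, {subset fv_term t <= xs}}.
Hypothesis s_free : {in fv_term s, forall y, y \notin xs}.
Let tbv : seq (cval L) := map (eval e) tb.
Let sv : cval L := eval e s.
Let g := gcdn (lcmv tbv) (mulv (proj sv)).

Lemma linked_args : linked (map (eval e) ts : seq (cval L)) = (idx sv == phase tbv %[mod g]).
Proof. by rewrite map_rcons /linked split_last_rcons. Qed.

Lemma args_shift_offset_on j :
  map (eval (shift_env (offset_on xs j) e)) tb = map (shift j) tbv /\
  eval (shift_env (offset_on xs j) e) s = sv.
Proof.
have sub : {subset tb <= ts} by move=> t ttb; rewrite mem_rcons inE ttb orbT.
split.
  apply: args_shift.
  - by move=> t /sub /ts_ok.
  - by apply/allP => t /sub /(allP ts_wf).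
  - by move=> r /flatten_mapP[t /sub tts rt]; apply: ts_reg; apply/flatten_mapP; exists t.
  - by move=> y /flatten_mapP[t /sub tts yt]; apply: ts_typed; apply/flatten_mapP; exists t.
  - by move=> y /flatten_mapP[t ttb /(tb_bound ttb) yxs]; rewrite /offset_on yxs.
have sts : s \in ts by rewrite mem_rcons mem_head.
have [_ /(_ (offset_on xs j) 0%N) H _] := ts_ok sts (allP ts_wf s sts)
  (regular_flatten ts_reg sts) (typed_on_arg ts_typed sts).
by rewrite H ?shift0 // => y /s_free /negbTE yxs; rewrite /offset_on yxs.
Qed.

Lemma linked_shift j : linked (map (eval (shift_env (offset_on xs j) e)) ts : seq (cval L)) =
  (idx sv == phase tbv + j %[mod g]).
Proof.
have [Etb Es] := args_shift_offset_on j.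
rewrite map_rcons Etb Es /linked split_last_rcons lcmv_shift -/g; congr (_ == _).
exact: modn_dvd (dvdn_gcdl _ _) (phase_shift j tbv).
Qed.

(** For the special quantifier rules: shifting the bound variables moves the phase of [tb] through
    all residues while [s] stays fixed, so a linked tuple is found over the same lifted
    assignment. *)
Lemma linked_shift_ex : exists j,
  linked (map (eval (shift_env (offset_on xs j) e)) ts : seq (cval L)).
Proof.
have g0 : (0 < g)%N by rewrite gcdn_gt0 lcmv_gt0.
have [j H] := shift_eqmod_ex (idx sv) (phase tbv) g0.
by exists j; rewrite linked_shift H.
Qed.

End Special.

Lemma mul_vars_gt0 (xs : seq (var V)) (ε : env L) :
  (0 < mul_vars xs ε)%N = all (fun x => 0 < mulv (ε x))%N xs.
Proof.
rewrite /mul_vars /prods; elim: xs => [|x xs IH] /=; first by rewrite big_nil.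
by rewrite big_cons muln_gt0 IH.
Qed.

Lemma sat_pos (xs : seq (var V)) (ε : env L) : @typed_on (lifted V) L xs ε ->
  sat ε (pos_mul xs) <-> (0 < mul_vars xs ε)%N.
Proof. by move=> H; rewrite mul_vars_gt0; apply: sat_pos_mul. Qed.

Lemma mul_vars_proj_gt0 (xs : seq (var V)) (e : env I) : (0 < mul_vars xs ⌊e⌋)%N.
Proof. by rewrite mul_vars_gt0; apply/allP => x _; apply: mulv_proj_gt0. Qed.

(** The copy of index 0 exists for every bound value, because the multiplicities are positive. *)
Lemma env_cover (xs : seq (var V)) (e : env I) (ε : env L) :
  @agree_off (lifted V) L xs ⌊e⌋ ε -> @typed_on (lifted V) L xs ε ->
  (0 < mul_vars xs ε)%N ->
  exists e' : env I, [/\ ⌊e'⌋ = ε, agree_off xs e e' & typed_on xs e'].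
Proof.
rewrite mul_vars_gt0 => Ha Ht /allP H.
pose e' : env I := fun y => if y \in xs then at_idx (ε y) 0 else e y.
have E : ⌊e'⌋ = ε.
  apply/funext => y; rewrite /e' /=; case: ifP => [yxs|/negbT yxs].
    by rewrite proj_at_idx // H.
  by rewrite Ha.
exists e'; split=> //; first by move=> y /negbTE yxs; rewrite /e' yxs.
by apply/typed_proj; rewrite E.
Qed.

Lemma agree_off_proj (xs : seq (var V)) (e e' : env I) :
  agree_off xs e e' -> @agree_off (lifted V) L xs ⌊e⌋ ⌊e'⌋.
Proof. by move=> H y yxs; rewrite /= H. Qed.

(** The guard [pos_mul] selects exactly the lifted assignments to [xs] that are projections of
    concrete ones. *)
Lemma all_envs_proj (xs : seq (var V)) (e : env I) (Q : env L -> Prop) :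
  (forall ε, @agree_off (lifted V) L xs ⌊e⌋ ε -> @typed_on (lifted V) L xs ε ->
     sat ε (pos_mul xs) -> Q ε) <->
  (forall e', agree_off xs e e' -> typed_on xs e' -> Q ⌊e'⌋).
Proof.
split=> H.
  move=> e' Ha Ht; have Ht' : @typed_on (lifted V) L xs ⌊e'⌋ by apply/typed_proj.
  by apply: H => //; [exact: agree_off_proj | apply/sat_pos; rewrite ?mul_vars_proj_gt0].
move=> ε Ha Ht /(sat_pos Ht) /(env_cover Ha Ht)[e' [<- Ha' Ht']].
exact: H.
Qed.

Lemma ex_envs_proj (xs : seq (var V)) (e : env I) (Q : env L -> Prop) :
  (exists ε, [/\ @agree_off (lifted V) L xs ⌊e⌋ ε, @typed_on (lifted V) L xs ε,
     sat ε (pos_mul xs) & Q ε]) <->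
  (exists e', [/\ agree_off xs e e', typed_on xs e' & Q ⌊e'⌋]).
Proof.
split=> [[ε [Ha Ht /(sat_pos Ht) /(env_cover Ha Ht)[e' [E Ha' Ht']] Qε]]|[e' [Ha Ht Qe']]].
  by exists e'; split=> //; rewrite E.
have Ht' : @typed_on (lifted V) L xs ⌊e'⌋ by apply/typed_proj.
exists ⌊e'⌋; split=> //; first exact: agree_off_proj.
by apply/sat_pos; rewrite ?mul_vars_proj_gt0.
Qed.

Lemma agree_off_offset_on (xs : seq (var V)) j (e e' : env I) :
  agree_off xs e e' -> agree_off xs e (shift_env (offset_on xs j) e').
Proof. by move=> H y yxs; rewrite shift_env_off ?H. Qed.

(** Common to both aggregate rules: the factor [Mulv xs] counts the concrete assignments over a
    lifted one, which leaves a concrete sum with the residual weight [w]. That weight is 1 in the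
    general rule. *)
Lemma eval_weighted_sum (xs : seq (var V)) (e : env I) (u w t : term (lifted V))
    (a : formula (lifted V)) : wf_binder xs ->
  (forall ε, @typed_on (lifted V) L xs ε ->
     num_of (eval ε u) = (mul_vars xs ε)%:R * num_of (eval ε w) * num_of (eval ε t)) ->
  eval ⌊e⌋ (@TSum (lifted V) u xs (FAnd (pos_mul xs) a)) =
  VNum (\sum_(e' <- envs xs e)
          if `[< sat ⌊e'⌋ a >] then num_of (eval ⌊e'⌋ w) * num_of (eval ⌊e'⌋ t) else 0).
Proof.
move=> wfx Hu; rewrite -[LHS]/(VNum (\sum_(ε <- _ | `[< sat _ (pos_mul xs) /\ sat _ a >])
  num_of (eval ε u))); congr VNum.
pose Q (ε : env L) : rat := if `[< sat ε a >] then num_of (eval ε w) * num_of (eval ε t) else 0.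
rewrite (@sum_envs_proj V L coprime_dom dvd_cod xs e Q wfx) big_mkcond; apply: eq_big_seq => ε.
move=> /envs_agree[_ Ht]; rewrite asbool_and Hu // /Q.
have -> : `[< sat ε (pos_mul xs) >] = (0 < mul_vars xs ε)%N.
  by apply/asboolP/idP => /(sat_pos Ht).
case: posnP => [->|_] /=; first by rewrite mul0r.
by case: ifP; rewrite ?mulr0 // mulrA.
Qed.

(** The residual weight is the inverse of the gcd of [Lcm(tb)] and [mul(s)]. By averaging over
    shifts, this weight can be traded for the condition that the argument tuple be linked, which is
    what the concrete atom adds to the lifted one. *)
Lemma eval_special_sum (xs : seq (var V)) (t : term V) p ts psi (e : env I) :
  wf_binder xs -> special xs ts ->
  term_ok t -> wf_term t -> regular (reg_term t) ->
  {in ts, forall t, term_ok t} -> wf_atom p ts -> all (@wf_term V) ts ->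
  regular (flatten (map (@reg_term V) ts)) ->
  form_ok psi -> wf_form psi -> regular (reg_form psi) ->
  typed_on (fv_term (TSum t xs (FAnd (FAtom p ts) psi))) e ->
  eval ⌊e⌋ (@TSum (lifted V)
    (tmul (special_factor xs (map (@chi_term V) ts)) (chi_term t)) xs
    (FAnd (pos_mul xs) (FAnd (chi_atom p ts) (chi_form psi)))) =
  proj (eval e (TSum t xs (FAnd (FAtom p ts) psi))).
Proof.
move=> wfx /specialP[tb [s [-> tb_bound s_free]]] okt wft regt okts wfp wfts regts
  okpsi wfpsi regpsi He.
have typed e' : e' \in envs xs e ->
    [/\ typed_on (fv_term t) e', typed_on (fvs (rcons tb s)) e' & typed_on (fv_form psi) e'].
  move=> /envs_agree[Ha Hx]; have He' := typed_on_env He Ha Hx.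
  by split; apply: typed_on_sub He' => y yt; rewrite !mem_cat yt ?orbT.
set w := tdiv (Lcm (map (@chi_term V) (rcons tb s)))
  (tmul (Lcm (map (@chi_term V) tb)) (mul_of (chi_term s))).
rewrite (@eval_weighted_sum xs e _ w (chi_term t)) // => [|ε Ht]; last first.
  rewrite map_rcons special_factor_rcons -[LHS]/(num_of (eval ε (Mulv xs)) *
    num_of (eval ε (Lcm (rcons (map (@chi_term V) tb) (chi_term s)))) /
    num_of (eval ε (tmul (Lcm (map (@chi_term V) tb)) (mul_of (chi_term s)))) *
    num_of (eval ε (chi_term t))).
  by rewrite eval_Mulv // /w map_rcons -!mulrA.
congr VNum; rewrite [RHS]big_mkcond /=.
pose tbv (e' : env I) : seq (cval L) := map (eval e') tb.
pose g e' := gcdn (lcmv (tbv e')) (mulv (proj (eval e s))).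
pose Q (ε : env L) : rat :=
  if `[< sat ε (FAnd (chi_atom p (rcons tb s)) (chi_form psi)) >]
  then num_of (eval ε (chi_term t)) else 0.
have Es e' : e' \in envs xs e -> eval e' s = eval e s.
  move=> /envs_agree[Ha _]; apply: (proj1 (coincidence I)) => y /s_free.
  exact: Ha.
(* First the weight is computed, from the fact that the lcm times the gcd is the product. *)
transitivity (\sum_(e' <- envs xs e) Q ⌊e'⌋ / (g e')%:R).
  apply: eq_big_seq => e' He'; have [_ Hts _] := typed e' He'.
  rewrite /Q; case: ifP => _; last by rewrite mul0r.
  rewrite mulrC; congr (_ * _).
  rewrite -[LHS]/(num_of (eval ⌊e'⌋ (Lcm (map (@chi_term V) (rcons tb s)))) /
    (num_of (eval ⌊e'⌋ (Lcm (map (@chi_term V) tb))) *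
     num_of (eval ⌊e'⌋ (mul_of (chi_term s))))).
  have mulok := args_mul_ok okts wfts regts Hts.
  have sub : {subset map (@chi_term V) tb <= map (@chi_term V) (rcons tb s)}.
    by move=> u; rewrite map_rcons mem_rcons inE => ->; rewrite orbT.
  have Ev := args_mulv okts wfts regts Hts.
  rewrite (mulok (chi_term s)); last by rewrite map_rcons mem_rcons mem_head.
  rewrite !eval_Lcm //; last by move=> u /sub /mulok.
  rewrite Ev; move: Ev; rewrite !map_rcons => /rcons_inj[Etb Esv].
  rewrite Etb [mulv (eval _ _)]Esv -/(tbv e') /= (Es e') // /g.
  set m := mulv _; set l := lcmv _.
  have -> : lcms (rcons (map (mulv \o @proj V L) (tbv e')) m) = lcmn l m.
    by rewrite /l /lcmv /lcms -cats1 big_cat big_seq1.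
  have l0 : l%:R != 0 :> rat by rewrite pnatr_eq0 -lt0n lcmv_gt0.
  have m0 : m%:R != 0 :> rat by rewrite pnatr_eq0 -lt0n mulv_proj_gt0.
  have g0 : (gcdn l m)%:R != 0 :> rat by rewrite pnatr_eq0 -lt0n gcdn_gt0 lcmv_gt0.
  rewrite -[lcms _]/l -natrM -muln_lcm_gcd natrM invfM mulrA mulfV ?mul1r //.
  apply: contraTneq (mulf_neq0 l0 m0) => E.
  by rewrite -natrM -muln_lcm_gcd natrM E mul0r eqxx.
(* The common multiple of the moduli is the multiplicity of [s], which is the same for all
   assignments because [s] contains no bound variable. *)
rewrite -(@sum_envs_phase V L _ _ xs e (mulv (proj (eval e s))) g
   (fun e' => phase (tbv e')) (idx (eval e s)) (fun e' => Q ⌊e'⌋)).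
- apply: eq_big_seq => e' He'; have [Ht Hts Hpsi] := typed e' He'.
  have -> : (idx (eval e s) == phase (tbv e') %[mod g e']) = linked (map (eval e') (rcons tb s)).
    by rewrite linked_args Es.
  rewrite /Q; have [-> _ _] := okt wft regt e' Ht; rewrite num_of_proj.
  have [lk|nlk] := boolP (linked _).
    congr (if _ then _ else _); apply: asbool_equiv_eq.
    have A := sat_atom okts wfts regts Hts wfp; have B := okpsi wfpsi regpsi e' Hpsi.
    by split=> [[Ha /B Hb]|[/A[Ha _] /B Hb]]; split=> //; apply/A.
  case: ifP => // /asboolP[Hat _].
  by case/negP: nlk; have [] := (proj1 (sat_atom okts wfts regts Hts wfp)) Hat.
- exact: mulv_proj_gt0.
- move=> e' He'; have [_ Hts _] := typed e' He'.
  have H j := args_shift_offset_on okts wfts regts Hts tb_bound s_free j.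
  split=> [|j|j|j]; first exact: dvdn_gcdr.
  + by rewrite proj_shift_env.
  + by rewrite /g /tbv (proj1 (H j)) lcmv_shift.
  + rewrite /tbv (proj1 (H j)); apply: modn_dvd (phase_shift j _).
    exact: dvdn_gcdl.
Qed.

Lemma chi_FEnum T n (e : env I) :
  sat ⌊e⌋ (chi_form (FEnum T n)) <-> sat e (FEnum (V := V) T n).
Proof.
set x : var (lifted V) := (0%N, TySym T).
pose S := @TSum (lifted V) (mul_of (TVar x)) [:: x] FTrue.
have E : eval ⌊e⌋ S = VNum #|cdom T|%:R.
  rewrite -[LHS]/(VNum (\sum_(ε <- _ | `[< True >]) num_of (eval ε (mul_of (TVar x))))).
  congr VNum; rewrite card_cdom big_mkcond (@sum_envs_cons (lifted V) L) big_map big_enum.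
  by apply: eq_bigr => d _; rewrite /= big_seq1 updxx asboolT.
rewrite -[X in X <-> _]/(eval ⌊e⌋ S = VNum n%:R) E.
by split=> [[/eqP]|->//]; rewrite eqr_nat => /eqP.
Qed.

(** Only atoms distinguish concrete from lifted truth, through [linked]. The constraints force it
    under the atom rule, shifts of bound variables arrange it under the special quantifier rules,
    and the factor accounts for it in aggregates. *)
Lemma chi_ok : (forall t, term_ok t) /\ (forall a, form_ok a).
Proof.
have cat2 (A B : seq (var V)) (e : env I) :
    typed_on (A ++ B) e -> typed_on A e /\ typed_on B e.
  by move=> H; split; apply: typed_on_sub H => y yt; rewrite mem_cat yt ?orbT.
apply: guarded_ind.
- move=> x _ _ e He; split=> // [κ j H|k H]; last by apply: H; rewrite mem_head.
  by rewrite /= /shift_env H ?mem_head.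
- by move=> b _ _ e He; split=> // k _; rewrite /coherent /= modn1.
- by move=> q _ _ e He; split=> // k _; rewrite /coherent /= modn1.
- move=> f ts IH /andP[wfa wfts] regts e He.
  have vsT : all2 (@has_ty _ cdom) (map (eval e) ts) (fdom f).
    by apply: (@has_ty_args V I) wfa; apply: args_has_ty.
  split.
  + by rewrite /= (args_proj IH) // (proj_app coprime_dom dvd_cod).
  + move=> κ j H; rewrite /= (args_shift IH wfts regts He H).
    exact: (app_shift coprime_dom dvd_cod).
  + move=> k H; apply: (coherent_app coprime_dom dvd_cod) => //.
    exact: args_coherent H.
- move=> o t1 t2 IH1 IH2 /and4P[_ _ wf1 wf2] /regular_cat[reg1 reg2].
  apply: numeric_ok; first by move=> e; eexists.
  move=> e /cat2[He1 He2] /=.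
  have [-> _ _] := IH1 wf1 reg1 e He1; have [-> _ _] := IH2 wf2 reg2 e He2.
  by rewrite !num_of_proj.
(* Terms built with [TLcm] are not well-formed source terms. *)
- by [].
- move=> t xs a IHt IHa G /and4P[_ wfx wft wfa] reg.
  apply: numeric_ok; first by move=> e; eexists.
  move=> e He; move: (sum_viewP t xs a) IHa wfa reg G He.
  case=> [p ts psi sp|{}a] IHa wfa.
    move=> /regular_cat[regt /regular_cat[regts regpsi]] [okts okpsi].
    have /andP[/andP[wfp wfts] wfpsi] := wfa.
    exact: eval_special_sum.
  move=> /regular_cat[regt rega] _ He.
  rewrite (@eval_weighted_sum xs e _ (TNum 1) (chi_term t)) // => [|ε Ht]; last first.
    rewrite -[LHS]/(num_of (eval ε (Mulv xs)) * num_of (eval ε (chi_term t))).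
    by rewrite eval_Mulv // mulr1.
  congr VNum; rewrite [RHS]big_mkcond; apply: eq_big_seq => e' /envs_agree[Ha Hx].
  have /cat2[He1 He2] := typed_on_env He Ha Hx.
  rewrite mul1r; have [-> _ _] := IHt wft regt e' He1; rewrite num_of_proj.
  by congr (if _ then _ else _); apply: asbool_equiv_eq; apply: IHa.
- by [].
- move=> p ts IH /andP[wfp wfts] /regular_cat[regp regts] e He.
  rewrite (sat_atom IH wfts regts He wfp); split=> [H|[]//]; split=> //.
  exact: reg_atom_linked H.
- move=> c t1 t2 IH1 IH2 /and4P[_ _ wf1 wf2] /regular_cat[reg1 reg2] e /cat2[He1 He2] /=.
  have [-> _ _] := IH1 wf1 reg1 e He1; have [-> _ _] := IH2 wf2 reg2 e He2.
  by rewrite !num_of_proj.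
- by move=> T n _ _ e _; apply: chi_FEnum.
- by move=> a IH wfa rega e He /=; rewrite (IH wfa rega e He).
- move=> a b IHa IHb /andP[wfa wfb] /regular_cat[rega regb] e /cat2[Ha Hb] /=.
  by rewrite (IHa wfa rega e Ha) (IHb wfb regb e Hb).
- move=> a b IHa IHb /andP[wfa wfb] /regular_cat[rega regb] e /cat2[Ha Hb] /=.
  by rewrite (IHa wfa rega e Ha) (IHb wfb regb e Hb).
- move=> a b IHa IHb /andP[wfa wfb] /regular_cat[rega regb] e /cat2[Ha Hb] /=.
  by rewrite (IHa wfa rega e Ha) (IHb wfb regb e Hb).
- move=> a b IHa IHb /andP[wfa wfb] /regular_cat[rega regb] e /cat2[Ha Hb] /=.
  by rewrite (IHa wfa rega e Ha) (IHb wfb regb e Hb).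
- move=> xs a IHa G /andP[wfx wfa] reg e He.
  move: (all_viewP xs a) IHa wfa reg G He; case=> [p ts psi sp|{}a] IHa wfa; last first.
    move=> rega _ He; rewrite !sat_FAll (all_envs_proj xs e (fun ε => sat ε (chi_form a))).
    by split=> H e' Ha Hx; apply/(IHa wfa rega e' (typed_on_env He Ha Hx)); apply: H.
  move=> /regular_cat[regts regpsi] [okts okpsi] He.
  have /andP[/andP[wfp wfts] wfpsi] := wfa.
  have [tb [s [Ets tb_bound s_free]]] := specialP sp.
  transitivity (forall e', agree_off xs e e' -> typed_on xs e' ->
      sat ⌊e'⌋ (chi_atom p ts) -> sat ⌊e'⌋ (chi_form psi)).
    rewrite sat_FAll -(all_envs_proj xs e
      (fun ε => sat ε (chi_atom p ts) -> sat ε (chi_form psi))).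
    split=> H ε Ha Hx; first by move=> Hp Hat; apply: H.
    by case=> Hp Hat; apply: H.
  rewrite sat_FAll; split=> H e' Ha Hx; have /cat2[Hts Hpsi] := typed_on_env He Ha Hx.
    move=> /(sat_atom okts wfts regts Hts wfp)[Hat _].
    by apply/(okpsi wfpsi regpsi e' Hpsi); apply: H.
  move=> Hat; subst ts.
  (* The concrete hypothesis is used at a shifted assignment, where the tuple is linked. The
     conclusion transfers back because the projection is unchanged. *)
  have [j Hj] := linked_shift_ex okts wfts regts Hts tb_bound s_free.
  have Hts' := typed_shift_env (offset_on xs j) Hts; have Hpsi' := typed_shift_env (offset_on xs j) Hpsi.
  rewrite -(proj_shift_env (offset_on xs j) e'); apply/(okpsi wfpsi regpsi _ Hpsi').
  apply: H; [exact: agree_off_offset_on | exact: typed_shift_env |].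
  by apply/(sat_atom okts wfts regts Hts' wfp); rewrite proj_shift_env.
- move=> xs a IHa G /andP[wfx wfa] reg e He.
  move: (ex_viewP xs a) IHa wfa reg G He; case=> [p ts psi sp|{}a] IHa wfa; last first.
    move=> rega _ He; rewrite !sat_FEx.
    transitivity (exists e', [/\ agree_off xs e e', typed_on xs e' &
        sat ⌊e'⌋ (chi_form a)]).
      rewrite -(ex_envs_proj xs e (fun ε => sat ε (chi_form a))).
      by split=> [[ε [Ha Hx []]]|[ε [Ha Hx]]]; exists ε.
    by split=> -[e' [Ha Hx H]]; exists e'; split=> //;
      apply/(IHa wfa rega e' (typed_on_env He Ha Hx)).
  move=> /regular_cat[regts regpsi] [okts okpsi] He.
  have /andP[/andP[wfp wfts] wfpsi] := wfa.
  have [tb [s [Ets tb_bound s_free]]] := specialP sp.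
  transitivity (exists e', [/\ agree_off xs e e', typed_on xs e' &
      sat ⌊e'⌋ (FAnd (chi_atom p ts) (chi_form psi))]).
    rewrite sat_FEx -(ex_envs_proj xs e
      (fun ε => sat ε (FAnd (chi_atom p ts) (chi_form psi)))).
    by split=> [[ε [Ha Hx []]]|[ε [Ha Hx]]]; exists ε.
  rewrite sat_FEx; split=> -[e' [Ha Hx [Hat Hp]]];
    have /cat2[Hts Hpsi] := typed_on_env He Ha Hx; last first.
    exists e'; split=> //; split; last exact/(okpsi wfpsi regpsi e' Hpsi).
    by have [] := (proj1 (sat_atom okts wfts regts Hts wfp)) Hat.
  (* The lifted witness yields a concrete one only after a shift that makes the tuple linked. *)
  subst ts; have [j Hj] := linked_shift_ex okts wfts regts Hts tb_bound s_free.
  have Hts' := typed_shift_env (offset_on xs j) Hts; have Hpsi' := typed_shift_env (offset_on xs j) Hpsi.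
  exists (shift_env (offset_on xs j) e'); split; [exact: agree_off_offset_on | exact: typed_shift_env |].
  split; first by apply/(sat_atom okts wfts regts Hts' wfp); rewrite proj_shift_env.
  by apply/(okpsi wfpsi regpsi _ Hpsi'); rewrite proj_shift_env.
Qed.

End Correctness.

(** * Arithmetic consequences and origin of the regularity constraints *)

Lemma reg_funP (V : vocab) (L : structure (lifted V)) (f : Defs.fsym V)
    (ws : seq (elem L)) :
  regular L (reg_fun f) -> all2 (@has_ty _ (dom L)) ws (fdom f) ->
  prods (map (@mulv V L) ws) = lcms (map (@mulv V L) ws) /\
  (mulv (fint (s := L) (inl f) ws) %| prods (map (@mulv V L) ws))%N.
Proof.
move=> reg wsT; set xs : seq (var V) := zip (iota 0 (size (fdom f))) (fdom f).
have Esz : size ws = size (fdom f).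
  by elim: (ws) (fdom f) wsT => [|w ws' IH] [|T Ts] //= /andP[_ /IH ->].
have Exs : size xs = size (fdom f) by rewrite size_zip size_iota minnn.
have nth_xs i : (i < size (fdom f))%N -> nth (0%N, TyBool) xs i = (i, nth TyBool (fdom f) i).
  by move=> lti; rewrite nth_zip ?size_iota // nth_iota.
(* The variable numbered [i] receives the [i]-th argument, so that the constraints speak of the
   tuple [ws]. *)
pose ε : env L := fun y => if y \in xs then nth (VBool false) ws y.1 else VBool false.
have xs_nth y : y \in xs -> exists2 i, (i < size (fdom f))%N & y = (i, nth TyBool (fdom f) i).
  move=> /(nthP (0%N, TyBool))[i]; rewrite Exs => lti <-.
  by exists i; rewrite ?nth_xs.
have Ews : map ε xs = ws.
  apply: (@eq_from_nth _ (VBool false)); first by rewrite size_map Exs.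
  rewrite size_map Exs => i lti; rewrite (nth_map (0%N, TyBool)) ?Exs //.
  by rewrite /ε mem_nth ?Exs // nth_xs.
have Ht : @typed_on (lifted V) L xs ε.
  move=> y yxs; have [i lti Ey] := xs_nth y yxs; rewrite /ε yxs {}Ey /=.
  elim: (ws) (fdom f) i lti wsT => [|w ws' IH] [|T Ts] [|i] //= lti /andP[] //.
  by move=> _; apply: IH.
have Ha : @agree_off (lifted V) L xs (fun=> VBool false) ε.
  by move=> y /negbTE yxs; rewrite /ε yxs.
have EM : eval ε (Mulv xs) = VNum (prods (map (@mulv V L) ws))%:R.
  by rewrite eval_Mulv // map_comp Ews.
split.
  have := reg _ (mem_head _ _); rewrite /models sat_FAll => /(_ ε Ha Ht) E.
  have {E} : eval ε (Mulv xs) = eval ε (Lcmv xs) := E.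
  rewrite EM eval_Lcmv // map_comp Ews => -[/eqP].
  by rewrite eqr_nat => /eqP.
set n : var (lifted V) := (size xs, TyNat).
have nxs : n \notin xs.
  apply/negP => /xs_nth[i lti [En _]]; move: lti.
  by rewrite -En Exs ltnn.
have := reg _ (mem_last _ _); rewrite /models sat_FAll => /(_ ε Ha Ht).
rewrite sat_FEx => -[ε' [Ha' Ht' E]].
set fxs := @TApp (lifted V) (inl f) (map (@TVar (lifted V)) xs).
have {E} : eval ε' (Mulv xs) = eval ε' (tmul (TVar n) (mul_of fxs)) := E.
have Eε : {in xs, ε' =1 ε}.
  move=> y yxs; apply: Ha'; rewrite inE; apply/eqP => En.
  by case/negP: nxs; move: yxs; rewrite En.
have -> : eval ε' (Mulv xs) = eval ε (Mulv xs).
  by apply: (proj1 (coincidence L)) => y /(@fv_Mulv V xs) /Eε.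
have Ef : eval ε' fxs = fint (s := L) (inl f) ws.
  by rewrite /= -map_comp -[in RHS]Ews; congr fint; apply/eq_in_map => y /Eε.
have okf : mul_ok ε' fxs.
  by apply: (@mul_okP V L ε' fxs (fcod f)); rewrite // Ef; apply: (@fint_ty _ L (inl f)).
rewrite EM -[eval ε' (tmul _ _)]/(VNum (num_of (ε' n) * num_of (eval ε' (mul_of fxs)))).
rewrite okf Ef => -[].
(* The quantified multiplier has type [TyNat], which turns an equation between rationals into
   divisibility. *)
have /natrP[k ->] : num_of (ε' n) \is a Num.nat.
  by apply: num_of_nat; apply: (Ht' n); rewrite mem_head.
by rewrite -natrM => /eqP; rewrite eqr_nat => /eqP ->; apply: dvdn_mull.
Qed.

(** Every constraint arising from the formula is that of some atom; when all multiplicities are 1,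
    such constraints hold whatever the atom. *)
Lemma reg_atom_of (V : vocab) :
  (forall (t : term V) r, r \in reg_term t ->
     exists p ts, r \in reg_atom (V := V) p ts) /\
  (forall (a : formula V) r, r \in reg_form a ->
     exists p ts, r \in reg_atom (V := V) p ts).
Proof.
have args (ts : seq (term V)) :
    {in ts, forall t, forall r, r \in reg_term t ->
      exists p ts, r \in reg_atom (V := V) p ts} ->
    forall r, r \in flatten (map (@reg_term V) ts) ->
      exists p ts, r \in reg_atom (V := V) p ts.
  by move=> IH r /flatten_mapP[t tts rt]; apply: IH rt.
have cat2 (A B : seq (formula (lifted V))) (P : formula (lifted V) -> Prop) :
    (forall r, r \in A -> P r) -> (forall r, r \in B -> P r) ->
    forall r, r \in A ++ B -> P r.
  by move=> HA HB r; rewrite mem_cat => /orP[/HA|/HB].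
apply: guarded_ind => //.
- by move=> o t1 t2 H1 H2; apply: cat2.
- move=> t xs a Ht; case: sum_viewP => [p ts psi _ _ [/args Hts Hpsi]|{}a Ha _].
    by apply: (cat2) => //; apply: cat2.
  exact: cat2.
- move=> p ts /args IH; apply: cat2 => // r rp.
  by exists p, ts.
- by move=> c t1 t2 H1 H2; apply: cat2.
- by move=> a b H1 H2; apply: cat2.
- by move=> a b H1 H2; apply: cat2.
- by move=> a b H1 H2; apply: cat2.
- by move=> a b H1 H2; apply: cat2.
- move=> xs a; case: all_viewP => [p ts psi _ _ [/args Hts Hpsi]|{}a Ha _ //].
  exact: cat2.
- move=> xs a; case: ex_viewP => [p ts psi _ _ [/args Hts Hpsi]|{}a Ha _ //].
  exact: cat2.
Qed.

(** * The lifting in which every multiplicity is 1 *)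

Section Trivial.
Variables (V : vocab) (I : structure V).

Definition lifted_fint (f : Defs.fsym (lifted V)) : seq (elem I) -> elem I :=
  match f with inl g => fint (s := I) g | inr _ => fun=> VNum 1 end.

Lemma lifted_fint_ty (f : Defs.fsym (lifted V)) vs :
  all2 (@has_ty _ (dom I)) vs (fdom f) -> has_ty (lifted_fint f vs) (fcod f).
Proof. by case: f => //= g; apply: fint_ty. Qed.

Definition trivial_lift : structure (lifted V) :=
  @Structure (lifted V) (dom I) lifted_fint (@pint V I) lifted_fint_ty.
Local Notation L := trivial_lift.

Lemma mul_of1 (e : env L) u : num_of (eval e (mul_of u)) = 1.
Proof. by rewrite /mul_of; case: (ty_of u). Qed.

Lemma Mul1 (e : env L) us : eval e (Mul us) = VNum 1.
Proof. by rewrite /Mul; elim: us => //= u us ->; rewrite mul_of1 mulr1. Qed.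

Lemma Lcm1 (e : env L) us : eval e (Lcm us) = VNum 1.
Proof.
rewrite /Lcm /=; congr VNum; rewrite !big_map big1_seq // => u _.
by rewrite mul_of1 truncn1.
Qed.

Lemma Mul_eq_Lcm1 (e : env L) us : sat e (form_eq (Mul us) (Lcm us)).
Proof. by rewrite -[sat _ _]/(eval e (Mul us) = eval e (Lcm us)) Mul1 Lcm1. Qed.

Lemma special_factor1 (e : env L) (xs : seq (var V)) us :
  num_of (eval e (special_factor xs us)) = 1.
Proof.
case: (lastP us) => // us' u; rewrite special_factor_rcons.
rewrite -[LHS]/((num_of (eval e (Mulv xs)) * num_of (eval e (Lcm (rcons us' u)))) /
  (num_of (eval e (Lcm us')) * num_of (eval e (mul_of u)))).
by rewrite /Mulv Mul1 !Lcm1 mul_of1.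
Qed.

Lemma sat_pos1 (e : env L) (xs : seq (var V)) : sat e (pos_mul xs).
Proof. by rewrite /= /Mulv Mul1 /= ltr01. Qed.

Lemma trivial_regular (r : formula (lifted V)) p ts :
  r \in reg_atom (V := V) p ts -> models L r.
Proof.
case: ts => // t ts; rewrite inE => /eqP ->.
rewrite /models sat_FAll => e' _ _ _; left.
exact: Mul_eq_Lcm1.
Qed.

Lemma trivial_reg_fun (r : formula (lifted V)) (f : Defs.fsym V) :
  r \in reg_fun f -> models L r.
Proof.
rewrite !inE => /orP[] /eqP ->; rewrite /models sat_FAll => e' _ _.
  exact: Mul_eq_Lcm1.
rewrite sat_FEx; set n := (_, TyNat).
(* With all multiplicities equal to 1, the multiplier 1 satisfies the divisibility constraint. *)
exists (upd e' n (VNum 1)); split.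
- by move=> y; rewrite inE /upd => /negbTE ->.
- by move=> y; rewrite inE => /eqP ->; rewrite updxx.
- rewrite -[sat _ _]/(eval _ (Mul _) = VNum (num_of (upd e' n (VNum 1) n) *
    num_of (eval (upd e' n (VNum 1)) (mul_of _)))).
  by rewrite Mul1 updxx mul_of1 mulr1.
Qed.

(** All factors evaluate to 1 and all guards are true, so the special and the general rules both
    reduce to the source construct. *)
Lemma trivial_chi :
  (forall (t : term V) (e : env I), wf_term t ->
     eval (M := L) e (chi_term t) = eval e t :> value (dom I)) /\
  (forall (a : formula V) (e : env I), wf_form a ->
     sat (M := L) e (chi_form a) <-> sat e a).
Proof.
have args ts (e : env I) :
    {in ts, forall t, forall e : env I, wf_term t ->
     eval (M := L) e (chi_term t) = eval e t :> value (dom I)} ->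
    all (@wf_term V) ts ->
    map (eval (M := L) e) (map (@chi_term V) ts) = map (eval e) ts :> seq (value (dom I)).
  move=> IH /allP wfts; rewrite -map_comp; apply/eq_in_map => t tts.
  exact: IH (wfts t tts).
have atom p ts (e : env I) :
    {in ts, forall t, forall e : env I, wf_term t ->
     eval (M := L) e (chi_term t) = eval e t :> value (dom I)} ->
    all (@wf_term V) ts ->
    sat (M := L) e (chi_atom p ts) <-> sat e (FAtom p ts).
  move=> IH wfts; rewrite /= (args _ _ IH wfts).
  by case: p.
have sum (t : term V) xs a (u : term (lifted V)) b (e : env I) :
    (forall e' : env I, num_of (eval (M := L) e' u) = num_of (M := I) (eval e' t)) ->
    (forall e' : env I, sat (M := L) e' b <-> sat e' a) ->
    eval (M := L) e (@TSum (lifted V) u xs b) = eval e (TSum t xs a) :> value (dom I).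
  move=> Hu Hb; congr VNum.
  transitivity (\sum_(e' <- envs (M := I) xs e | `[< sat (M := L) e' b >])
    num_of (eval (M := L) e' u)); first by [].
  by apply: eq_big => [e'|e' _]; [apply: asbool_equiv_eq | apply: Hu].
have mul1t (w : term (lifted V)) (t : term V) (e' : env I) :
    num_of (eval (M := L) e' w) = 1 -> wf_term t ->
    (forall e : env I, wf_term t ->
     eval (M := L) e (chi_term t) = eval e t :> value (dom I)) ->
    num_of (eval (M := L) e' (tmul w (chi_term t))) = num_of (M := I) (eval e' t).
  by move=> Ew wft IH; rewrite /= Ew mul1r IH.
apply: guarded_ind.
- by [].
- by [].
- by [].
- by move=> f ts IH e /andP[_ wfts]; rewrite /= (args _ _ IH wfts).
- move=> o t1 t2 IH1 IH2 e /and4P[_ _ wf1 wf2] /=.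
  by rewrite IH1 // IH2.
- by [].
- move=> t xs a IHt IHa G e /and4P[_ _ wft wfa].
  move: (sum_viewP t xs a) IHa wfa G; case=> [p ts psi _|{}a] IHa wfa.
    move=> [okts okpsi]; have /andP[/andP[wfp wfts] wfpsi] := wfa.
    apply: sum => e'; first by apply: mul1t; rewrite ?special_factor1.
    have A := atom p ts e' okts wfts; have B := okpsi e' wfpsi.
    by split=> [[_ [/A Ha /B]]|[/A Ha /B Hb]]; split=> //; apply: sat_pos1.
  move=> _; apply: sum => e'; first by apply: mul1t; rewrite // /Mulv Mul1.
  have B := IHa e' wfa.
  by split=> [[_ /B]|/B] //; split=> //; apply: sat_pos1.
- by [].
- by move=> p ts IH e /andP[_ wfts]; apply: atom.
- move=> c t1 t2 IH1 IH2 e /and4P[_ _ wf1 wf2] /=.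
  by rewrite IH1 // IH2.
- move=> T n e _; set x : var (lifted V) := (0%N, TySym T).
  pose S := @TSum (lifted V) (mul_of (TVar x)) [:: x] FTrue.
  have E : eval (M := L) e S = VNum #|dom I T|%:R.
    rewrite -[LHS]/(VNum (\sum_(ε <- _ | `[< True >]) num_of (eval ε (mul_of (TVar x))))).
    congr VNum; rewrite big_mkcond (@sum_envs_cons (lifted V) L) big_map big_enum.
    rewrite (eq_bigr (fun=> 1)) => [|d _]; last by rewrite /= big_seq1 asboolT.
    by rewrite sumr_const.
  rewrite -[X in X <-> _]/(eval (M := L) e S = VNum n%:R) E.
  by split=> [[/eqP]|->//]; rewrite eqr_nat => /eqP.
- by move=> a IH e wfa /=; rewrite IH.
- by move=> a b IHa IHb e /andP[wfa wfb] /=; rewrite IHa // IHb.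
- by move=> a b IHa IHb e /andP[wfa wfb] /=; rewrite IHa // IHb.
- by move=> a b IHa IHb e /andP[wfa wfb] /=; rewrite IHa // IHb.
- by move=> a b IHa IHb e /andP[wfa wfb] /=; rewrite IHa // IHb.
- move=> xs a IHa G e /andP[_ wfa].
  move: (all_viewP xs a) IHa wfa G; case=> [p ts psi _|{}a] IHa wfa.
    move=> [okts okpsi]; have /andP[/andP[wfp wfts] wfpsi] := wfa.
    rewrite !sat_FAll; split=> H e' Ha Hx; have := H e' Ha Hx;
      have A := atom p ts e' okts wfts; have B := okpsi e' wfpsi => He'.
      by move=> /A Hat; apply/B; apply: He'; split=> //; apply: sat_pos1.
    by case=> _ /A Hat; apply/B; apply: He'.
  move=> _; rewrite !sat_FAll; split=> H e' Ha Hx; have := H e' Ha Hx.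
    by move=> He'; apply/(IHa e' wfa); apply: He'; apply: sat_pos1.
  by move=> He' _; apply/(IHa e' wfa).
- move=> xs a IHa G e /andP[_ wfa].
  move: (ex_viewP xs a) IHa wfa G; case=> [p ts psi _|{}a] IHa wfa.
    move=> [okts okpsi]; have /andP[/andP[wfp wfts] wfpsi] := wfa.
    rewrite !sat_FEx; split=> -[e' [Ha Hx He']]; exists e'; split=> //;
      have A := atom p ts e' okts wfts; have B := okpsi e' wfpsi.
      by case: He' => _ [/A Hat /B].
    by case: He' => /A Hat /B Hp; split; [exact: sat_pos1|].
  move=> _; rewrite !sat_FEx; split=> -[e' [Ha Hx He']]; exists e'; split=> //.
    by case: He' => _ /(IHa e' wfa).
  by split; [exact: sat_pos1 | apply/(IHa e' wfa)].
Qed.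

End Trivial.

(** * Equivalence of concrete and lifted satisfiability *)

Theorem theorem1 (V : vocab) (phi : formula V) (n : tsym V -> nat)
    (hphi : sentence phi) :
  (exists I : structure V,
     (forall T : tsym V, #|dom I T| = n T) /\ models I phi)
  <->
  (exists L : structure (lifted V),
     (forall T : tsym V, \sum_(l : dom L T) mul_elt l = (n T)%:R) /\
     models L (translate phi)).
Proof.
have /andP[wf /eqP closed] := hphi; split=> [[I [cardI HI]]|[L [cardL HL]]].
  exists (trivial_lift I); split=> [T|].
    by rewrite /mul_elt /= sumr_const cardI.
  apply/sat_bigconj => r; rewrite inE mem_cat => /predU1P[->|/orP[rphi|/flatten_mapP[f _ rf]]].
  - exact/(proj2 (trivial_chi I)).
  - by have [p [ts rp]] := proj2 (reg_atom_of V) phi r rphi; apply: trivial_regular rp.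
  - exact: trivial_reg_fun rf.
have reg : regular L (chi_form phi :: reg_form phi ++
    flatten (map (@reg_fun V) (enum (Defs.fsym V)))).
  exact/sat_bigconj.
have reg_phi : regular L (reg_form phi).
  by move=> r rphi; apply: reg; rewrite inE mem_cat rphi orbT.
have reg_f f : regular L (reg_fun f).
  move=> r rf; apply: reg; rewrite inE mem_cat; apply/orP; right; apply/orP; right.
  by apply/flatten_mapP; exists f; rewrite ?mem_enum.
have cop (f : Defs.fsym V) ws wsT := proj1 (@reg_funP V L f ws (reg_f f) wsT).
have dvd (f : Defs.fsym V) ws wsT := proj2 (@reg_funP V L f ws (reg_f f) wsT).
exists (concretization cop dvd); split=> [T|].
  by apply/eqP; rewrite -(eqr_nat rat) card_cdom cardL.
(* The default assignment projects to the default assignment, since [VBool false] is a built-in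
   value; closedness makes the typing condition vacuous. *)
apply/(proj2 (chi_ok cop dvd) phi wf reg_phi); first by rewrite closed.
by apply: reg; rewrite mem_head.
Qed.
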